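(* Let each $f_i:\mathbb{R}^m\to\mathbb{R}$ ($i\in[n]$) be $r+1$ times continuously differentiable for some $r\ge 1$ with $\nabla f_i$ being $L_i$-Lipschitz continuous, let $F=\sum_i f_i$ be coercive and real-analytic, let the digraph $\mathcal G$ be strongly connected (connected, if undirected), let $\mathbf R,\mathbf C$ satisfy the weight-matrix assumption in the context, and let the step-size $\alpha$ (and parameters $\epsilon_x,\epsilon_y,\epsilon,\varkappa$) be chosen as in the context. Let the function $L$ defined in the context be a KŁ function with $\phi(s)=c_0s^{1-\theta}$, for some constants $c_0>0$ and $\theta\in[0,1)$. Let $\{\mathbf z^\nu=(\mathbf{x}^\nu,\mathbf{y}^\nu)\}$ be a sequence generated by the DOGT iteration and $\mathbf z^\infty$ its limit. Then: (i) if $\theta=0$, $\{\mathbf z^\nu\}$ converges to $\mathbf z^\infty$ in a finite number of iterations; (ii) if $\theta\in(0,1/2]$, then $\|\mathbf z^\nu-\mathbf z^\infty\|\le \bar C\tau^\nu$ for all $\nu\ge\bar\nu$, for some $\tau\in[0,1)$, $\bar\nu\in\mathbb{N}_+$, $\bar C>0$; (iii) if $\theta\in(1/2,1)$, then $\|\mathbf z^\nu-\mathbf z^\infty\|\le \bar C\nu^{-\frac{1-\theta}{2\theta-1}}$ for all $\nu\ge\bar\nu$, for some $\bar\nu\in\mathbb{N}_+$, $\bar C>0$.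
   Context: KŁ property of a differentiable $U$ at $\acute{\mathbf z}$: there exist $\eta\in(0,+\infty]$, a neighborhood $\mathcal V_{\acute{\mathbf z}}$ and a continuous concave $\phi:[0,\eta)\to\mathbb{R}_+$ with $\phi(0)=0$, $\phi$ $C^1$ on $(0,\eta)$, $\phi'>0$ on $(0,\eta)$, and $\phi'(U(\mathbf z)-U(\acute{\mathbf z}))\|\nabla U(\mathbf z)\|\ge1$ for all $\mathbf z\in\mathcal V_{\acute{\mathbf z}}$ with $U(\acute{\mathbf z})<U(\mathbf z)<U(\acute{\mathbf z})+\eta$. $U$ is a KŁ function if this holds at every point of its domain. Functions: $F=\sum_{i=1}^nf_i$; for $\mathbf{x}=[\mathbf{x}_1^\top,\ldots,\mathbf{x}_n^\top]^\top\in\mathbb{R}^{mn}$, $F_c(\mathbf{x})=\sum_if_i(\mathbf{x}_i)$. $L_c=\max_iL_i$ is the Lipschitz constant of $\nabla F_c$, and $\mathsf L$ denotes a Lipschitz constant of $\nabla F$. Coercive: tends to $+\infty$ as the argument tends to infinity in norm. Network and weights: $\mathcal G=([n],\mathcal E)$ is a (possibly directed) graph. For a nonnegative $\mathbf A\in\mathbb{R}^{n\times n}$, $\mathcal G_A$ is the digraph on $[n]$ with edge $(j,i)$ iff $A_{ij}>0$, and $\mathcal R_A$ is the set of roots of directed spanning trees of $\mathcal G_A$. Weight-matrix assumption: $\mathbf R$ is nonnegative row-stochastic with $R_{ii}>0$; $\mathbf C$ is nonnegative column-stochastic with $C_{ii}>0$; both are compliant to $\mathcal G$ (for $i\ne j$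 the $(i,j)$ entry is zero if $(j,i)\notin\mathcal E$); $\mathcal G_R$ and $\mathcal G_{C^\top}$ each contain a spanning tree, and $\mathcal R_R\cap\mathcal R_{C^\top}\neq\emptyset$. Let $\mathbf r,\mathbf c$ be the stochastic vectors with $\mathbf r^\top\mathbf R=\mathbf r^\top$, $\mathbf C\mathbf c=\mathbf c$, with minimal/maximal entries $r_{\min},r_{\max},c_{\min},c_{\max}$ (the constants below presuppose $r_{\min},c_{\min}>0$); $\zeta=\mathbf r^\top\mathbf c>0$. Let $\|\mathbf{x}\|_R=\|(\mathrm{diag}(\sqrt{\mathbf r})\otimes\mathbf I_m)\mathbf{x}\|_2$, $\|\mathbf{y}\|_C=\|(\mathrm{diag}(\sqrt{\mathbf c})^{-1}\otimes\mathbf I_m)\mathbf{y}\|_2$, $\rho_R=\|\mathrm{diag}(\sqrt{\mathbf r})(\mathbf R-\mathbf 1\mathbf r^\top)\mathrm{diag}(\sqrt{\mathbf r})^{-1}\|_2<1$, $\rho_C=\|\mathrm{diag}(\sqrt{\mathbf c})^{-1}(\mathbf C-\mathbf c\mathbf 1^\top)\mathrm{diag}(\sqrt{\mathbf c})\|_2<1$, $\mathbf J_R=(\mathbf 1\mathbf r^\top)\otimes\mathbf I_m$, $\mathbf J_C=(\mathbf c\mathbf 1^\top)\otimes\mathbf I_m$. DOGT: $\mathbf{x}^{\nu+1}=\mathbf W_R\mathbf{x}^\nu-\alpha\mathbf{y}^\nu$, $\mathbf{y}^{\nu+1}=\mathbf W_C\mathbf{y}^\nu+\nabla F_c(\mathbf{x}^{\nu+1})-\nabla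 F_c(\mathbf{x}^\nu)$, with $\mathbf W_R=\mathbf R\otimes\mathbf I_m$, $\mathbf W_C=\mathbf C\otimes\mathbf I_m$, $\mathbf{x}^0\in\mathbb{R}^{mn}$ and $\mathbf{y}^0\in\nabla F_c(\mathbf{x}^0)+\mathrm{span}(\mathbf W_C-\mathbf I)$ (span = column space). In this setting the sequence is convergent. Constants: $K_{2,R}=1/\sqrt{r_{\min}}$, $K_{2,C}=\sqrt{c_{\max}}$, $K_{C,2}=1/\sqrt{c_{\min}}$, $K_{R,C}=\sqrt{r_{\max}c_{\max}}$; $K_2=2K_{R,C}^2(1+\frac1{\epsilon_x})$, $K_3=2n(1+\frac1{\epsilon_x})$, $K_4=3K_{C,2}^2K_{2,C}^2L_c^2$, $K_5=3K_{C,2}^2L_c^2$, $K_6=3K_{C,2}^2K_{2,R}^2L_c^2$. Parameters: $0<\epsilon_x<\frac{1-\rho_R^2}{2\rho_R^2}$, $0<\epsilon_y<\frac{1-\rho_C^2}{\rho_C^2}$, $0<\epsilon<\frac{2\zeta}{1+\zeta}$, $0<\varkappa\le\frac{\rho_R^2\epsilon_x}{K_6(1+1/\epsilon_y)}$, and $\alpha>0$ satisfies $$\alpha<\frac{2\,(1-\rho_R^2(1+2\epsilon_x))}{nL_c^2K_{2,R}^2(1+\zeta/\epsilon)},\quad \alpha<\frac{1-\rho_C^2(1+\epsilon_y)}{\frac1{2\varkappa}K_{2,C}^2(1+\frac1\epsilon+2\mathsf L)+\frac{K_2}{\varkappa}+K_4(1+\frac1{\epsilon_y})},\quad \alpha<\frac{\zeta-\frac\epsilon2(\zeta+1)}{\mathsf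 L\zeta^2+K_3+K_5\varkappa}.$$ $L(\mathbf{x},\mathbf{y})=F_c(\mathbf J_R\mathbf{x})+\|(\mathbf I-\mathbf J_R)\mathbf{x}\|_R^2+\varkappa\|(\mathbf I-\mathbf J_C)\mathbf{y}\|_C^2$. $\mathbb{N}_+$ is the set of nonnegative integers. *)

(* Defs.v *)
From HB Require Import structures.
From mathcomp Require Import all_boot all_order all_algebra.
From mathcomp Require Import all_classical all_reals all_analysis.
From mathcomp Require Import mxtens.

Set Implicit Arguments.
Unset Strict Implicit.
Unset Printing Implicit Defensive.

Import Order.TTheory GRing.Theory Num.Theory.
Import numFieldNormedType.Exports.

Local Open Scope classical_set_scope.
Local Open Scope ring_scope.

(* The library norm `|x| on matrices is the sup norm; it induces the same
   topology as the Euclidean norm but not the same Lipschitz constants. *)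
Definition enorm (K : realType) (p : nat) (v : 'cV[K]_p) : K :=
  Num.sqrt (\sum_i v i 0 ^+ 2).

Definition opnorm2 (K : realType) (p q : nat) (A : 'M[K]_(p, q)) : K :=
  sup [set enorm (A *m v) | v in [set v : 'cV[K]_q | enorm v <= 1]].

Definition grad (K : realType) (p : nat) (U : 'cV[K]_p -> K) (v : 'cV[K]_p) :
    'cV[K]_p :=
  \col_i 'D_(delta_mx i 0) U v.

Definition is_lipschitz (K : realType) (p q : nat) (k : K)
    (g : 'cV[K]_p -> 'cV[K]_q) : Prop :=
  forall u v, enorm (g u - g v) <= k * enorm (u - v).

Fixpoint is_Ck (K : realType) (p k : nat) (U : 'cV[K]_p -> K) : Prop :=
  if k is k'.+1 then
    (forall v, differentiable U v) /\
    (forall i, is_Ck k' (fun v => 'D_(delta_mx i 0) U v))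
  else continuous U.

Definition coercive (K : realType) (p : nat) (U : 'cV[K]_p -> K) : Prop :=
  forall M : K, exists B : K, forall v, B <= enorm v -> M <= U v.

(* One term of a power series in p variables; b is the multi-index. *)
Definition monomial (K : realType) (p : nat) (a : {ffun 'I_p -> nat} -> K)
    (h : 'cV[K]_p) (b : {ffun 'I_p -> nat}) : K :=
  a b * \prod_i h i 0 ^+ b i.

(* Around every point, U is the sum of an absolutely convergent power series.
   Absolute convergence makes the summation order immaterial; the partial sums
   run over the boxes of multi-indices with all entries < N. *)
Definition real_analytic (K : realType) (p : nat) (U : 'cV[K]_p -> K) : Prop :=
  forall v, exists (a : {ffun 'I_p -> nat} -> K) (d : K), 0 < d /\
    forall h : 'cV[K]_p, enorm h < d ->
      cvgn (fun N => \sum_(b : {ffun 'I_p -> 'I_N})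
               `|monomial a h [ffun i => val (b i)]|) /\
      (fun N => \sum_(b : {ffun 'I_p -> 'I_N})
               monomial a h [ffun i => val (b i)]) @ \oo --> U (v + h).

(* The Kurdyka-Lojasiewicz property of U at z with a prescribed desingularizing
   function phi; eta and the neighbourhood may depend on z. *)
Definition KL_at (K : realType) (p : nat) (phi : K -> K) (U : 'cV[K]_p -> K)
    (z : 'cV[K]_p) : Prop :=
  exists eta : \bar K, (0 < eta)%E /\
    let D := [set s : K | 0 <= s /\ (s%:E < eta)%E] in
    let D0 := [set s : K | 0 < s /\ (s%:E < eta)%E] in
    [/\ [/\ {within D, continuous phi},
            phi 0 = 0,
            (forall s, D s -> 0 <= phi s) &
            (forall s t l, D s -> D t -> 0 <= l <= 1 ->
               l * phi s + (1 - l) * phi t <= phi (l * s + (1 - l) * t))],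
        (forall s, D0 s -> derivable phi s 1),
        (forall s, D0 s -> {for s, continuous (derive1 phi)}),
        (forall s, D0 s -> 0 < derive1 phi s) &
        \forall w \near z, U z < U w -> ((U w)%:E < (U z)%:E + eta)%E ->
          1 <= derive1 phi (U w - U z) * enorm (grad U w)].

Definition KL_function (K : realType) (p : nat) (phi : K -> K)
    (U : 'cV[K]_p -> K) : Prop :=
  forall z, KL_at phi U z.

(* Stacked vectors: x : 'cV_(n * m) has the n blocks blk x i : 'cV_m, and
   A *t 1%:M is the Kronecker product of A with the identity of size m. *)
Definition blk (K : realType) (n m : nat) (x : 'cV[K]_(n * m)) (i : 'I_n) :
    'cV[K]_m :=
  \col_j x (mxtens_index (i, j)) 0.

Definition kronI (K : realType) (n m : nat) (A : 'M[K]_n) : 'M[K]_(n * m) :=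
  A *t (1%:M : 'M[K]_m).

Definition Fsum (K : realType) (n m : nat) (f : 'I_n -> 'cV[K]_m -> K)
    (v : 'cV[K]_m) : K :=
  \sum_i f i v.

Definition Fc (K : realType) (n m : nat) (f : 'I_n -> 'cV[K]_m -> K)
    (x : 'cV[K]_(n * m)) : K :=
  \sum_i f i (blk x i).

(* A graph is given by its edge relation: e j i stands for the edge (j, i).
   An undirected graph is a symmetric e. *)
Definition strongly_connected (n : nat) (e : rel 'I_n) : Prop :=
  forall i j, connect e i j.

Definition graph_of (K : realType) (n : nat) (A : 'M[K]_n) : rel 'I_n :=
  fun j i => 0 < A i j.

(* A directed spanning tree with root k is given by its parent map pa: every
   node i other than k has the single incoming edge (pa i, i), and going up
   from any node eventually reaches k. *)
Definition is_spanning_tree (n : nat) (e : rel 'I_n) (k : 'I_n)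
    (pa : 'I_n -> 'I_n) : Prop :=
  (forall i, i != k -> e (pa i) i) /\
  (forall i, exists t : nat, iter t pa i = k).

Definition root_set (K : realType) (n : nat) (A : 'M[K]_n) : set 'I_n :=
  [set k | exists pa, is_spanning_tree (graph_of A) k pa].

Definition compliant (K : realType) (n : nat) (e : rel 'I_n) (A : 'M[K]_n) :
    Prop :=
  forall i j, i != j -> ~~ e j i -> A i j = 0.

Record weight_assumption (K : realType) (n : nat) (e : rel 'I_n)
    (R C : 'M[K]_n) : Prop := {
  R_ge0 : forall i j, 0 <= R i j;
  R_row_stochastic : forall i, \sum_j R i j = 1;
  R_diag_gt0 : forall i, 0 < R i i;
  C_ge0 : forall i j, 0 <= C i j;
  C_col_stochastic : forall j, \sum_i C i j = 1;
  C_diag_gt0 : forall i, 0 < C i i;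
  R_compliant : compliant e R;
  C_compliant : compliant e C;
  R_spanning_tree : root_set R !=set0;
  C_spanning_tree : root_set C^T !=set0;
  common_root : (root_set R `&` root_set C^T) !=set0 }.

Definition stochastic_vec (K : realType) (n : nat) (v : 'cV[K]_n) : Prop :=
  (forall i, 0 <= v i 0) /\ \sum_i v i 0 = 1.

(* Minimum and maximum of the entries of a stochastic vector: these lie in
   [0, 1], so the default values 1 and 0 do not interfere. *)
Definition vmin (K : realType) (n : nat) (v : 'cV[K]_n) : K :=
  \big[Num.min/1]_i v i 0.

Definition vmax (K : realType) (n : nat) (v : 'cV[K]_n) : K :=
  \big[Num.max/0]_i v i 0.

(* The default value 0 is harmless: Lipschitz constants are nonnegative. *)
Definition Lmax (K : realType) (n : nat) (L : 'I_n -> K) : K :=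
  \big[Num.max/0]_i L i.

Definition dsqrt (K : realType) (n : nat) (v : 'cV[K]_n) : 'M[K]_n :=
  diag_mx (\row_i Num.sqrt (v i 0)).

Definition ones (K : realType) (n : nat) : 'cV[K]_n := const_mx 1.

Definition zeta (K : realType) (n : nat) (r c : 'cV[K]_n) : K :=
  (r^T *m c) 0 0.

Definition normR (K : realType) (n m : nat) (r : 'cV[K]_n)
    (x : 'cV[K]_(n * m)) : K :=
  enorm (kronI m (dsqrt r) *m x).

Definition normC (K : realType) (n m : nat) (c : 'cV[K]_n)
    (y : 'cV[K]_(n * m)) : K :=
  enorm (kronI m (invmx (dsqrt c)) *m y).

Definition rhoR (K : realType) (n : nat) (R : 'M[K]_n) (r : 'cV[K]_n) : K :=
  opnorm2 (dsqrt r *m (R - ones K n *m r^T) *m invmx (dsqrt r)).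

Definition rhoC (K : realType) (n : nat) (C : 'M[K]_n) (c : 'cV[K]_n) : K :=
  opnorm2 (invmx (dsqrt c) *m (C - c *m (ones K n)^T) *m dsqrt c).

Definition JR (K : realType) (n m : nat) (r : 'cV[K]_n) : 'M[K]_(n * m) :=
  kronI m (ones K n *m r^T).

Definition JC (K : realType) (n m : nat) (c : 'cV[K]_n) : 'M[K]_(n * m) :=
  kronI m (c *m (ones K n)^T).

Record DOGT (K : realType) (n m : nat) (f : 'I_n -> 'cV[K]_m -> K)
    (R C : 'M[K]_n) (alpha : K) (x y : nat -> 'cV[K]_(n * m)) : Prop := {
  DOGT_init : exists w, y 0 = grad (Fc f) (x 0) + (kronI m C - 1%:M) *m w;
  DOGT_x : forall nu, x nu.+1 = kronI m R *m x nu - alpha *: y nu;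
  DOGT_y : forall nu, y nu.+1 =
    kronI m C *m y nu + grad (Fc f) (x nu.+1) - grad (Fc f) (x nu) }.

Definition K2R (K : realType) (n : nat) (r : 'cV[K]_n) : K :=
  1 / Num.sqrt (vmin r).
Definition K2C (K : realType) (n : nat) (c : 'cV[K]_n) : K :=
  Num.sqrt (vmax c).
Definition KC2 (K : realType) (n : nat) (c : 'cV[K]_n) : K :=
  1 / Num.sqrt (vmin c).
Definition KRC (K : realType) (n : nat) (r c : 'cV[K]_n) : K :=
  Num.sqrt (vmax r * vmax c).

Definition K2 (K : realType) (n : nat) (r c : 'cV[K]_n) (epsx : K) : K :=
  2 * KRC r c ^+ 2 * (1 + 1 / epsx).
Definition K3 (K : realType) (n : nat) (epsx : K) : K :=
  2 * n%:R * (1 + 1 / epsx).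
Definition K4 (K : realType) (n : nat) (c : 'cV[K]_n) (Lc : K) : K :=
  3 * KC2 c ^+ 2 * K2C c ^+ 2 * Lc ^+ 2.
Definition K5 (K : realType) (n : nat) (c : 'cV[K]_n) (Lc : K) : K :=
  3 * KC2 c ^+ 2 * Lc ^+ 2.
Definition K6 (K : realType) (n : nat) (r c : 'cV[K]_n) (Lc : K) : K :=
  3 * KC2 c ^+ 2 * K2R r ^+ 2 * Lc ^+ 2.

(* The bounds on epsx and epsy are (1 - rhoR^2) / (2 rhoR^2) and
   (1 - rhoC^2) / rhoC^2, multiplied out so that a vanishing rhoR or rhoC
   gives the bound +oo (in the library x / 0 = 0). *)
Record admissible (K : realType) (n : nat) (R C : 'M[K]_n) (r c : 'cV[K]_n)
    (Lc LF epsx epsy eps kappa alpha : K) : Prop := {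
  epsx_gt0 : 0 < epsx;
  epsx_lt : epsx * (2 * rhoR R r ^+ 2) < 1 - rhoR R r ^+ 2;
  epsy_gt0 : 0 < epsy;
  epsy_lt : epsy * rhoC C c ^+ 2 < 1 - rhoC C c ^+ 2;
  eps_gt0 : 0 < eps;
  eps_lt : eps < 2 * zeta r c / (1 + zeta r c);
  kappa_gt0 : 0 < kappa;
  kappa_le : kappa <= rhoR R r ^+ 2 * epsx / (K6 r c Lc * (1 + 1 / epsy));
  alpha_gt0 : 0 < alpha;
  alpha_lt1 : alpha <
    2 * (1 - rhoR R r ^+ 2 * (1 + 2 * epsx)) /
    (n%:R * Lc ^+ 2 * K2R r ^+ 2 * (1 + zeta r c / eps));
  alpha_lt2 : alpha <
    (1 - rhoC C c ^+ 2 * (1 + epsy)) /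
    (1 / (2 * kappa) * K2C c ^+ 2 * (1 + 1 / eps + 2 * LF)
     + K2 r c epsx / kappa + K4 c Lc * (1 + 1 / epsy));
  alpha_lt3 : alpha <
    (zeta r c - eps / 2 * (zeta r c + 1)) /
    (LF * zeta r c ^+ 2 + K3 n epsx + K5 c Lc * kappa) }.

Definition merit (K : realType) (n m : nat) (f : 'I_n -> 'cV[K]_m -> K)
    (r c : 'cV[K]_n) (kappa : K) (x y : 'cV[K]_(n * m)) : K :=
  Fc f (JR m r *m x) + normR r ((1%:M - JR m r) *m x) ^+ 2
  + kappa * normC c ((1%:M - JC m c) *m y) ^+ 2.

(* Main.v *)
Require Import Defs.
From mathcomp Require Import all_boot all_order all_algebra.
From mathcomp Require Import all_classical all_reals all_analysis.
From mathcomp Require Import mxtens ring lra.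

Set Implicit Arguments.
Unset Strict Implicit.
Unset Printing Implicit Defensive.

Import Order.TTheory GRing.Theory Num.Theory.
Import numFieldNormedType.Exports.

Local Open Scope classical_set_scope.
Local Open Scope ring_scope.

(** Write [X i], [Y i] for the blocks of [x] and [y].  Three quantities vanish at
    a stationary state of the iteration: the consensus error [xgap r X], the
    squared [normR] of [(I - JR) x]; the tracking error [ygap c Y], the squared
    [normC] of [(I - JC) y]; and the squared length of [\sum_i Y i], which is
    the sum of the local gradients because [C] is column stochastic
    ([DOGT_track]).  Their sum [gap] governs everything:
    - the merit function drops by at least a multiple of [gap] at each step
      ([merit_descent]);
    - its gradient is at most a multiple of [sqrt gap] ([grad_merit_le]);
    - a step has length at most a multiple of [sqrt gap] ([step_length]).

    The rates follow from these three facts and the Kurdyka-Lojasiewicz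
    inequality at the limit alone ([KL_descent_rates]).  Let [l] be the excess of
    the merit function over its limit.  By concavity of [s `^ (1 - theta)], the
    decrease of [l `^ (1 - theta)] in a step is at least a multiple of
    [l `^ (- theta) * gap], and the inequality bounds [l `^ (- theta)] below by
    a multiple of [1 / sqrt gap]; so step lengths telescope and the distance to
    the limit is at most a multiple of [l `^ (1 - theta)].  The inequality also
    gives [l `^ (2 theta) <= B (l - l+)], which makes [l] vanish after finitely
    many steps, decay geometrically, or decay like [nu `^ (- 1 / (2 theta - 1))],
    according to [theta].

    Descent of the merit function combines the quadratic upper bound for [F] at
    the weighted average ([objective_step]) with contraction of the two errors
    ([xgap_step], [ygap_step]), where [R] and [C] contract by [rhoR] and [rhoC]
    in the weighted norms ([wsq_mix_le]).  The length of [(R - I) x] is up to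
    [1 + rhoR] times that of the consensus error, a factor absent from the
    constant [K6].  It is absorbed by unequal splittings: [2 / 5 * epsx] replaces
    [epsx] in the contraction of the consensus error, and the square of the
    step is split with weights 6/5 and 6 instead of 3.  This costs larger
    constants in front of [alpha ^+ 2], which the step-size bounds cover: they
    force [alpha <= 1 / 4], and they count a variance that is at most 1/4
    as [n >= 2] ([stepsize_slack]). *)

(** * Real powers and the rates they force *)

(** The tangent inequality of a concave power.  Put [u = t / s] and
    [w = 1 + p (u - 1)]: adding [p] times [ln (u / w) <= u / w - 1] and [1 - p]
    times [ln (1 / w) <= 1 / w - 1] gives exactly [p ln u <= ln w]. *)
Lemma powR_concave_tangent (K : realType) (p s t : K) :
  0 <= p <= 1 -> 0 < s -> 0 <= t ->
  p * s `^ (p - 1) * (s - t) <= s `^ p - t `^ p.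
Proof.
move=> /andP[p0 p1] s0 t0.
have [->|pN0] := eqVneq p 0; first by rewrite !powRr0 mul0r mul0r subrr.
have pgt0 : 0 < p by rewrite lt_neqAle eq_sym pN0.
have sp : s * s `^ (p - 1) = s `^ p by rewrite mulr_powRB1// ltW.
move: t0; rewrite le_eqVlt => /predU1P[<-|t0].
  rewrite powR0 ?gt_eqF// !subr0 -mulrA [_ * s]mulrC sp.
  by rewrite ler_piMl// powR_ge0.
pose u := t / s.
have u0 : 0 < u by rewrite divr_gt0.
have tE : t = s * u by rewrite /u mulrC divfK// gt_eqF.
suff bern : u `^ p <= 1 + p * (u - 1).
  rewrite tE powRM ?(ltW s0) ?(ltW u0)//.
  have -> : p * s `^ (p - 1) * (s - s * u) = p * (s * s `^ (p - 1)) * (1 - u)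
    by ring.
  rewrite sp.
  have := ler_wpM2l (powR_ge0 s p) bern; lra.
set w := 1 + p * (u - 1).
have w0 : 0 < w.
  have := mulr_gt0 pgt0 u0; rewrite /w; nra.
have lnle (x : K) : 0 < x -> ln x <= x - 1.
  by move=> x0; have := @le_ln1Dx _ (x - 1); rewrite subrKC; apply; lra.
rewrite /powR gt_eqF// -[leRHS]lnK ?posrE// ler_expR.
have l1 : ln u - ln w <= u / w - 1 by rewrite -ln_div ?posrE// lnle// divr_gt0.
have l2 : - ln w <= w^-1 - 1 by rewrite -lnV ?posrE// lnle// invr_gt0.
have e0 : p * (u / w - 1) + (1 - p) * (w^-1 - 1) = 0.
  have -> : p * (u / w - 1) + (1 - p) * (w^-1 - 1) = w * w^-1 - 1
    by rewrite {3}/w; ring.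
  by rewrite divff ?subrr// gt_eqF.
have h1 := ler_wpM2l p0 l1.
have h2 : (1 - p) * - ln w <= (1 - p) * (w^-1 - 1).
  by apply: ler_wpM2l l2; lra.
lra.
Qed.

(** The tangent inequality of a convex power, from [expR x >= 1 + x] and
    [ln u <= u - 1] with [u = t / s]. *)
Lemma powR_convex_tangent (K : realType) (q s t : K) :
  0 <= q -> 0 < s -> 0 < t ->
  s `^ (- q) + q * s `^ (- q - 1) * (s - t) <= t `^ (- q).
Proof.
move=> q0 s0 t0; pose u := t / s.
have u0 : 0 < u by rewrite divr_gt0.
have tE : t = s * u by rewrite /u mulrC divfK// gt_eqF.
suff bern : 1 + q * (1 - u) <= u `^ (- q).
  rewrite tE powRM ?(ltW s0) ?(ltW u0)//.
  have sp : s * s `^ (- q - 1) = s `^ (- q).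
    rewrite -{1}(powRr1 (ltW s0)) -powRD ?subrKC//.
    by apply/implyP => _; rewrite gt_eqF.
  have -> : q * s `^ (- q - 1) * (s - s * u) = q * (s * s `^ (- q - 1)) * (1 - u)
    by ring.
  rewrite sp.
  have := ler_wpM2l (powR_ge0 s (- q)) bern; lra.
have lnu : ln u <= u - 1.
  by have := @le_ln1Dx _ (u - 1); rewrite subrKC; apply; lra.
rewrite /powR gt_eqF//; apply: le_trans (expR_ge1Dx _).
have := ler_wpM2l q0 lnu; lra.
Qed.

(** The recursion [l `^ (2 theta) <= B (l - l+)] is a discrete form of
    [l' = - l `^ (2 theta) / B]: constant speed for [theta = 0], at least
    exponential decay up to [theta = 1 / 2], and beyond it linear growth of
    [l `^ (1 - 2 theta)]. *)
Section Rates.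
Variables (K : realType) (l d : nat -> K) (theta B M : K) (N : nat).
Hypothesis B_gt0 : 0 < B.
Hypothesis M_gt0 : 0 < M.
Hypothesis l_ge0 : forall nu, (N <= nu)%N -> 0 <= l nu.
Hypothesis l_step : forall nu, (N <= nu)%N -> l nu.+1 <= l nu.
Hypothesis l_rec : forall nu, (N <= nu)%N -> 0 < l nu ->
  l nu `^ (2 * theta) <= B * (l nu - l nu.+1).
Hypothesis d_le : forall nu, (N <= nu)%N -> d nu <= M * l nu `^ (1 - theta).

Let l_mono nu k : (N <= nu)%N -> l (nu + k)%N <= l nu.
Proof.
move=> Nnu; elim: k => [|k IHk]; first by rewrite addn0.
by rewrite addnS (le_trans _ IHk)// l_step// (leq_trans Nnu)// leq_addr.
Qed.

Lemma finite_rate : theta = 0 ->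
  exists N', forall nu, (N' <= nu)%N -> d nu <= 0.
Proof.
move=> th0.
have [k lk] : exists k, l (N + k)%N <= 0.
  apply/not_existsP => lpos.
  have {}lpos k : 0 < l (N + k)%N by rewrite ltNge; apply/negP/lpos.
  (* with theta = 0 every step loses at least B^-1 *)
  have drop k : l (N + k)%N <= l N - k%:R / B.
    elim: k => [|k IHk]; first by rewrite addn0 mul0r subr0.
    have := l_rec (leq_addr k N) (lpos k).
    rewrite th0 mulr0 powRr0 mulrC -ler_pdivrMr// addnS -natr1 => h.
    have -> : (k%:R + 1) / B = k%:R / B + 1 / B by ring.
    lra.
  have lNB : 0 <= l N * B by rewrite mulr_ge0 ?l_ge0// ltW.
  have := archi_boundP lNB; set k := Num.bound _ => hk.
  have := lt_le_trans (lpos k) (drop k).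
  rewrite subr_gt0 ltr_pdivrMr//; lra.
exists (N + k)%N => nu Nknu.
have Nnu : (N <= nu)%N := leq_trans (leq_addr k N) Nknu.
have l0 : l nu = 0.
  apply/eqP; rewrite eq_le l_ge0// andbT (le_trans _ lk)//.
  by rewrite -(subnKC Nknu) l_mono// leq_addr.
by rewrite (le_trans (d_le Nnu))// l0 th0 subr0 powRr1// mulr0.
Qed.

Lemma linear_rate : 0 < theta <= 1 / 2 ->
  (exists N1, forall nu, (N1 <= nu)%N -> l nu <= 1) ->
  exists (tau Cbar : K) (nubar : nat), [/\ 0 <= tau < 1, 0 < Cbar &
    forall nu : nat, (nubar <= nu)%N -> d nu <= Cbar * tau ^+ nu].
Proof.
move=> /andP[th0 th12] [N1 lN1].
pose N2 := maxn N N1.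
have NN2 : (N <= N2)%N := leq_maxl _ _.
pose q := 1 - (B + 1)^-1.
have B1 : 1 < B + 1 by rewrite ltrDr.
have q0 : 0 < q by rewrite subr_gt0 invf_lt1//; lra.
have q1 : q < 1 by rewrite /q gtrBl invr_gt0; lra.
have step nu : (N2 <= nu)%N -> l nu.+1 <= q * l nu.
  move=> N2nu; have Nnu : (N <= nu)%N := leq_trans NN2 N2nu.
  have [lnu|] := ltP 0 (l nu); last first.
    move=> h; have l0 : l nu = 0 by apply/eqP; rewrite eq_le h l_ge0.
    by rewrite l0 mulr0 -l0 l_step.
  have hle : l nu <= l nu `^ (2 * theta).
    apply: ger1_powR; last by lra.
    by rewrite lnu lN1// (leq_trans _ N2nu)// leq_maxr.
  have h : l nu <= (B + 1) * (l nu - l nu.+1).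
    have := l_rec Nnu lnu; have := l_step Nnu; lra.
  have : (B + 1)^-1 * l nu <= l nu - l nu.+1.
    by rewrite mulrC ler_pdivrMr; [rewrite mulrC | lra].
  rewrite /q; lra.
have geo k : l (N2 + k)%N <= q ^+ k * l N2.
  elim: k => [|k IHk]; first by rewrite addn0 expr0 mul1r.
  rewrite addnS (le_trans (step _ (leq_addr _ _)))// exprS -mulrA.
  by rewrite ler_wpM2l// ltW.
pose p := 1 - theta.
have p0 : 0 < p by rewrite /p; lra.
pose tau := q `^ p.
have tau0 : 0 < tau by exact: powR_gt0.
have tau1 : tau < 1.
  have := @gt0_ltr_powR K p p0 q 1; rewrite powR1; apply => //.
    by rewrite nnegrE ltW.
  by rewrite nnegrE.
have lN2 : 0 <= l N2 by exact: l_ge0.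
exists tau, (M * (l N2 `^ p + 1) / tau ^+ N2), N2; split.
- by rewrite tau1 (ltW tau0).
- by rewrite divr_gt0 ?exprn_gt0// mulr_gt0// ltr_wpDl// powR_ge0.
move=> nu N2nu.
have := d_le (leq_trans NN2 N2nu); rewrite -/p => /le_trans; apply.
rewrite -!mulrA ler_pM2l//.
rewrite -(subnKC N2nu) exprD mulKf; last by rewrite gt_eqF ?exprn_gt0.
set k := (nu - N2)%N.
have lle : l (N2 + k)%N `^ p <= (q ^+ k * l N2) `^ p.
  apply: ge0_ler_powR; rewrite ?nnegrE ?(ltW p0) ?geo//.
    by rewrite l_ge0// (leq_trans NN2)// leq_addr.
  by rewrite mulr_ge0// exprn_ge0// ltW.
apply: le_trans lle _.
have qk : (q ^+ k) `^ p = tau ^+ k.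
  rewrite -(powR_mulrn k (ltW q0)) -(powR_mulrn k (ltW tau0)) /tau.
  by rewrite -!powRrM mulrC.
rewrite powRM ?exprn_ge0 ?(ltW q0)// qk mulrC ler_wpM2r ?exprn_ge0 ?(ltW tau0)//.
by rewrite lerDl.
Qed.

Lemma sublinear_rate : 1 / 2 < theta < 1 ->
  exists (Cbar : K) (nubar : nat), 0 < Cbar /\
    forall nu : nat, (nubar <= nu)%N ->
      d nu <= Cbar * nu%:R `^ (- ((1 - theta) / (2 * theta - 1))).
Proof.
move=> /andP[th12 th1].
pose s := 2 * theta - 1.
have s0 : 0 < s by rewrite /s; lra.
(* the convex function t `^ (- s) turns the recursion into linear growth *)
have grow k : 0 < l (N + k)%N -> k%:R * (s / B) <= l (N + k)%N `^ (- s).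
  elim: k => [|k IHk] lk; first by rewrite mul0r powR_ge0.
  rewrite addnS in lk *.
  have lk0 : 0 < l (N + k)%N by rewrite (lt_le_trans lk)// l_step// leq_addr.
  have := powR_convex_tangent (ltW s0) lk0 lk.
  apply: le_trans; rewrite -natr1 mulrDl mul1r lerD ?IHk//.
  have := l_rec (leq_addr k N) lk0.
  have -> : 2 * theta = - (- s - 1) by rewrite /s; ring.
  rewrite powRN => h.
  have P0 : 0 < l (N + k)%N `^ (- s - 1) by exact: powR_gt0.
  rewrite ler_pdivrMr// -!mulrA ler_peMr ?(ltW s0)//.
  move: h; rewrite -(ler_pM2l P0) divff ?gt_eqF//; lra.
pose q := (1 - theta) / s.
pose A := s / (B * 2).
have A0 : 0 < A by rewrite divr_gt0// mulr_gt0.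
exists (M * A `^ (- q)), (2 * N).+1; split; first by rewrite mulr_gt0// powR_gt0.
move=> nu nuN.
have Nnu : (N <= nu)%N.
  by apply: leq_trans (ltnW nuN); rewrite leq_pmull.
have nu0 : 0 < (nu%:R : K) by rewrite ltr0n (leq_trans _ nuN).
apply: (le_trans (d_le Nnu)); rewrite -mulrA ler_pM2l//.
rewrite -powRM ?(ltW A0)// -/s -/q.
have [lnu|] := ltP 0 (l nu); last first.
  move=> h; have l0 : l nu = 0 by apply/eqP; rewrite eq_le h l_ge0.
  by rewrite l0 powR0 ?powR_ge0// subr_eq0 eq_sym lt_eqF.
have := grow (nu - N)%N; rewrite subnKC// => /(_ lnu) g.
have h : A * nu%:R <= l nu `^ (- s).
  apply: le_trans g; rewrite /A invfM [s * _]mulrA -mulrA mulrC.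
  rewrite ler_wpM2r ?divr_ge0 ?(ltW s0) ?(ltW B_gt0)//.
  rewrite ler_pdivrMl// natrB//.
  have : ((2 * N)%:R : K) <= nu%:R by rewrite ler_nat ltnW.
  rewrite natrM; lra.
have An0 : 0 < A * nu%:R by rewrite mulr_gt0.
have q0 : 0 <= q by rewrite divr_ge0 ?(ltW s0)//; lra.
have -> : l nu `^ (1 - theta) = (l nu `^ (- s)) `^ (- q).
  by rewrite -powRrM /q mulrNN mulrC divfK// gt_eqF.
have P0 : 0 < l nu `^ (- s) by exact: powR_gt0.
rewrite ![_ `^ (- q)]powRN lef_pV2 ?posrE ?powR_gt0//.
by apply: ge0_ler_powR; rewrite ?nnegrE ?(ltW An0) ?(ltW P0).
Qed.

End Rates.

(** * Euclidean inner product *)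

Definition dot (K : realType) (p : nat) (u v : 'cV[K]_p) : K := (u^T *m v) 0 0.

Notation nsq u := (dot u u).

Section Dot.
Variables (K : realType) (p : nat).
Implicit Types (u v w : 'cV[K]_p) (a t : K).

Lemma dotE u v : dot u v = \sum_j u j 0 * v j 0.
Proof. by rewrite /dot mxE; apply: eq_bigr => j _; rewrite mxE. Qed.

Lemma dotC u v : dot u v = dot v u.
Proof. by rewrite !dotE; apply: eq_bigr => j _; rewrite mulrC. Qed.

Lemma dotDr w u v : dot w (u + v) = dot w u + dot w v.
Proof. by rewrite /dot mulmxDr mxE. Qed.

Lemma dotDl w u v : dot (u + v) w = dot u w + dot v w.
Proof. by rewrite ![dot _ w]dotC dotDr. Qed.

Lemma dotZr w a u : dot w (a *: u) = a * dot w u.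
Proof. by rewrite /dot -scalemxAr mxE. Qed.

Lemma dotZl w a u : dot (a *: u) w = a * dot u w.
Proof. by rewrite ![dot _ w]dotC dotZr. Qed.

Lemma dotNr w u : dot w (- u) = - dot w u.
Proof. by rewrite -scaleN1r dotZr mulN1r. Qed.

Lemma dotNl w u : dot (- u) w = - dot u w.
Proof. by rewrite ![dot _ w]dotC dotNr. Qed.

Lemma dot_sumr (I : finType) w (F : I -> 'cV[K]_p) :
  dot w (\sum_i F i) = \sum_i dot w (F i).
Proof. by rewrite /dot mulmx_sumr summxE. Qed.

Lemma dot_suml (I : finType) w (F : I -> 'cV[K]_p) :
  dot (\sum_i F i) w = \sum_i dot (F i) w.
Proof. by rewrite dotC dot_sumr; apply: eq_bigr => i _; rewrite dotC. Qed.

Lemma nsq_ge0 u : 0 <= nsq u.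
Proof. by rewrite dotE sumr_ge0// => j _; rewrite -expr2 sqr_ge0. Qed.

Lemma nsq0 : nsq (0 : 'cV[K]_p) = 0.
Proof. by rewrite -[X in dot X _](scale0r (0 : 'cV[K]_p)) dotZl mul0r. Qed.

Lemma nsq_eq0 u : nsq u = 0 -> u = 0.
Proof.
rewrite dotE => /eqP; rewrite psumr_eq0; last first.
  by move=> j _; rewrite -expr2 sqr_ge0.
move=> /allP h; apply/colP => j; rewrite mxE.
by have := h j (mem_index_enum _); rewrite /= -expr2 sqrf_eq0 => /eqP.
Qed.

Lemma nsqN u : nsq (- u) = nsq u.
Proof. by rewrite dotNl dotNr opprK. Qed.

Lemma nsqZ a u : nsq (a *: u) = a ^+ 2 * nsq u.
Proof. by rewrite dotZl dotZr expr2 mulrA. Qed.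

Lemma nsqD u v : nsq (u + v) = nsq u + 2 * dot u v + nsq v.
Proof. by rewrite dotDl !dotDr [dot v u]dotC; ring. Qed.

Lemma nsqB u v : nsq (u - v) = nsq u - 2 * dot u v + nsq v.
Proof. by rewrite nsqD dotNr nsqN mulrN. Qed.

Lemma enormE u : enorm u = Num.sqrt (nsq u).
Proof. by rewrite /enorm dotE. Qed.

Lemma enorm_ge0 u : 0 <= enorm u.
Proof. by rewrite enormE sqrtr_ge0. Qed.

Lemma sqr_enorm u : enorm u ^+ 2 = nsq u.
Proof. by rewrite enormE sqr_sqrtr// nsq_ge0. Qed.

Lemma dot_young t u v : 0 < t -> 2 * dot u v <= t * nsq u + t^-1 * nsq v.
Proof.
move=> t0; have := nsq_ge0 (t *: u - v); rewrite nsqB nsqZ dotZl.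
have tV : t^-1 * t = 1 by rewrite mulVf// gt_eqF.
move=> /(ler_wpM2l (ltW (_ : 0 < t^-1))); rewrite invr_gt0 => /(_ t0).
have -> : t^-1 * (t ^+ 2 * nsq u - 2 * (t * dot u v) + nsq v) =
  (t^-1 * t) * (t * nsq u - 2 * dot u v) + t^-1 * nsq v by ring.
rewrite tV; lra.
Qed.

Lemma dot_youngN t u v : 0 < t -> - 2 * dot u v <= t * nsq u + t^-1 * nsq v.
Proof.
by move=> /(@dot_young t (- u) v); rewrite nsqN dotNl mulrN -mulNr.
Qed.

Lemma nsqD_young t u v : 0 < t ->
  nsq (u + v) <= (1 + t) * nsq u + (1 + t^-1) * nsq v.
Proof. by move=> /(@dot_young t u v); rewrite nsqD; lra. Qed.

Lemma cauchy_schwarz u v : dot u v ^+ 2 <= nsq u * nsq v.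
Proof.
have [v0|vN0] := eqVneq (nsq v) 0.
  rewrite v0 mulr0 (nsq_eq0 v0) -(scale0r (0 : 'cV[K]_p)) dotZr mul0r.
  by rewrite expr0n.
have vgt0 : 0 < nsq v by rewrite lt_neqAle eq_sym vN0 nsq_ge0.
have := nsq_ge0 (nsq v *: u - dot u v *: v).
rewrite nsqB !nsqZ dotZl dotZr => h.
have {}h : 0 <= nsq v * (nsq u * nsq v - dot u v ^+ 2) by lra.
by rewrite pmulr_rge0// subr_ge0 in h.
Qed.

Lemma dot_le u v : `|dot u v| <= enorm u * enorm v.
Proof.
rewrite -(ler_pXn2r (_ : 0 < 2)%N) ?nnegrE ?mulr_ge0 ?enorm_ge0//.
by rewrite exprMn !sqr_enorm real_normK ?num_real// cauchy_schwarz.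
Qed.

Lemma enormD u v : enorm (u + v) <= enorm u + enorm v.
Proof.
rewrite -(ler_pXn2r (_ : 0 < 2)%N) ?nnegrE ?addr_ge0 ?enorm_ge0//.
rewrite sqrrD !sqr_enorm nsqD.
have := le_trans (ler_norm _) (dot_le u v); lra.
Qed.

Lemma enormN u : enorm (- u) = enorm u.
Proof. by rewrite !enormE nsqN. Qed.

Lemma enormZ a u : enorm (a *: u) = `|a| * enorm u.
Proof. by rewrite !enormE nsqZ sqrtrM ?sqr_ge0// sqrtr_sqr. Qed.

Lemma enorm0 : enorm (0 : 'cV[K]_p) = 0.
Proof. by rewrite enormE nsq0 sqrtr0. Qed.

Lemma enorm_le_sqrt u a : nsq u <= a -> enorm u <= Num.sqrt a.
Proof. by move=> h; rewrite enormE ler_wsqrtr. Qed.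

Lemma enorm_le0 u : enorm u <= 0 -> u = 0.
Proof.
move=> h; apply: nsq_eq0; rewrite -sqr_enorm.
have -> : enorm u = 0 by apply/eqP; rewrite eq_le h enorm_ge0.
by rewrite expr0n.
Qed.

End Dot.

Lemma lipschitz_sqr (K : realType) (p q : nat) (k : K)
    (g : 'cV[K]_p -> 'cV[K]_q) u v :
  is_lipschitz k g -> nsq (g u - g v) <= k ^+ 2 * nsq (u - v).
Proof.
move=> gk; rewrite -!sqr_enorm -exprMn.
by rewrite ler_pXn2r ?nnegrE ?enorm_ge0// (le_trans _ (gk u v))// enorm_ge0.
Qed.

(** The set of which [opnorm2] is the supremum is bounded by the Frobenius
    norm. *)
Lemma enorm_mulmx (K : realType) (p q : nat) (A : 'M[K]_(p, q)) v :
  enorm (A *m v) <= opnorm2 A * enorm v.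
Proof.
have dotrow i (w : 'cV[K]_q) : (A *m w) i 0 = dot (row i A)^T w.
  rewrite mxE dotE; apply: eq_bigr => j _; by rewrite !mxE.
pose B := Num.sqrt (\sum_i nsq (row i A)^T).
have bnd w : enorm w <= 1 -> enorm (A *m w) <= B.
  move=> w1; apply: enorm_le_sqrt; rewrite dotE; apply: ler_sum => i _.
  rewrite -expr2 dotrow (le_trans (cauchy_schwarz _ _))//.
  rewrite ler_piMr ?nsq_ge0// -sqr_enorm -(expr1n K 2).
  by rewrite ler_pXn2r ?nnegrE ?enorm_ge0.
have [v0|vN0] := eqVneq (enorm v) 0.
  have -> : v = 0 by apply: enorm_le0; rewrite v0.
  by rewrite mulmx0 !enorm0 mulr0.
have vgt0 : 0 < enorm v by rewrite lt_neqAle eq_sym vN0 enorm_ge0.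
rewrite -ler_pdivrMr// mulrC -[X in X * _]gtr0_norm ?invr_gt0// -enormZ scalemxAr.
apply: sup_upper_bound.
  split; last by exists B => _ /= [w w1 <-]; exact: bnd.
  by exists (enorm (A *m 0)), 0 => //=; rewrite enorm0.
exists ((enorm v)^-1 *: v) => //=.
by rewrite enormZ gtr0_norm ?invr_gt0// mulVf.
Qed.

Lemma opnorm2_0 (K : realType) (p q : nat) : opnorm2 (0 : 'M[K]_(p, q)) = 0.
Proof.
rewrite /opnorm2 -[RHS](@sup1 K); congr sup; apply/seteqP; split => [_ [w _ <-]|_ ->] /=.
  by rewrite mul0mx enorm0.
by exists 0; [rewrite /= enorm0 | rewrite mul0mx enorm0].
Qed.

(** * Weighted norms of block vectors *)

(** Stacked vectors are handled through their families of blocks, so that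
    Kronecker products disappear: [mix A] is the action of [kronI m A], and
    [wsq] is the squared [normR] for the weights [r i 0], the squared [normC]
    for the weights [(c i 0)^-1]. *)
Definition wsq (K : realType) (n m : nat) (w : 'I_n -> K)
  (X : 'I_n -> 'cV[K]_m) : K := \sum_i w i * nsq (X i).

Definition mix (K : realType) (n m : nat) (A : 'M[K]_n)
  (X : 'I_n -> 'cV[K]_m) (i : 'I_n) : 'cV[K]_m := \sum_j A i j *: X j.

Definition wmean (K : realType) (n m : nat) (w : 'I_n -> K)
  (X : 'I_n -> 'cV[K]_m) : 'cV[K]_m := \sum_i w i *: X i.

Section Weighted.
Variables (K : realType) (n m : nat).
Implicit Types (w : 'I_n -> K) (X Y : 'I_n -> 'cV[K]_m) (A : 'M[K]_n).

Lemma wsq_ge0 w X : (forall i, 0 <= w i) -> 0 <= wsq w X.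
Proof. by move=> w0; rewrite sumr_ge0// => i _; rewrite mulr_ge0// nsq_ge0. Qed.

Lemma ler_wsq w w' X Y : (forall i, w i * nsq (X i) <= w' i * nsq (Y i)) ->
  wsq w X <= wsq w' Y.
Proof. by move=> h; apply: ler_sum => i _. Qed.

Lemma wsqZl a w X : wsq (fun i => a * w i) X = a * wsq w X.
Proof. by rewrite mulr_sumr; apply: eq_bigr => i _; rewrite mulrA. Qed.

Lemma wsqZr a w X : wsq w (fun i => a *: X i) = a ^+ 2 * wsq w X.
Proof. by rewrite mulr_sumr; apply: eq_bigr => i _; rewrite nsqZ mulrCA. Qed.

Lemma wsqD_young t w X Y : 0 < t -> (forall i, 0 <= w i) ->
  wsq w (fun i => X i + Y i) <= (1 + t) * wsq w X + (1 + t^-1) * wsq w Y.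
Proof.
move=> t0 w0; rewrite !mulr_sumr -big_split /=; apply: ler_sum => i _.
have := ler_wpM2l (w0 i) (nsqD_young (X i) (Y i) t0).
lra.
Qed.

Lemma wsqN w X : wsq w (fun i => - X i) = wsq w X.
Proof. by apply: eq_bigr => i _; rewrite nsqN. Qed.

Lemma wsqB_young t w X Y : 0 < t -> (forall i, 0 <= w i) ->
  wsq w (fun i => X i - Y i) <= (1 + t) * wsq w X + (1 + t^-1) * wsq w Y.
Proof. by move=> t0 w0; rewrite -(wsqN w Y) wsqD_young. Qed.

(** The variance formula, source of all the projection and averaging bounds. *)
Lemma wsq_mean w X : \sum_i w i = 1 ->
  wsq w X = wsq w (fun i => X i - wmean w X) + nsq (wmean w X).
Proof.
move=> w1; set u := wmean w X.
have uu : nsq u = \sum_i w i * dot (X i) u.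
  by rewrite [LHS]dot_suml; apply: eq_bigr => i _; rewrite dotZl.
have -> : wsq w (fun i => X i - u) =
    wsq w X - 2 * (\sum_i w i * dot (X i) u) + (\sum_i w i) * nsq u.
  clearbody u; rewrite /wsq mulr_sumr mulr_suml -sumrN -!big_split /=.
  by apply: eq_bigr => i _; rewrite nsqB; ring.
rewrite w1 -uu; ring.
Qed.

Lemma wsq_center_le w X : \sum_i w i = 1 ->
  wsq w (fun i => X i - wmean w X) <= wsq w X.
Proof. by move=> w1; rewrite [leRHS](wsq_mean _ w1) lerDl nsq_ge0. Qed.

Lemma nsq_wmean_le w X : \sum_i w i = 1 -> (forall i, 0 <= w i) ->
  nsq (wmean w X) <= wsq w X.
Proof. by move=> w1 w0; rewrite [leRHS](wsq_mean _ w1) lerDr wsq_ge0. Qed.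

(** [opnorm2] only sees scalar mixing; the blocks are mixed one coordinate at
    a time. *)
Lemma wsq_mix_le w A (s s' : 'rV[K]_n) X :
  (forall i, s 0 i ^+ 2 = w i) -> diag_mx s' *m diag_mx s = 1%:M ->
  wsq w (mix A X) <= opnorm2 (diag_mx s *m A *m diag_mx s') ^+ 2 * wsq w X.
Proof.
move=> sw s's; set B := _ *m _ *m _.
pose V j := \col_i X i j 0 : 'cV[K]_n.
have wsqE Y : wsq w Y = \sum_j nsq (diag_mx s *m \col_i Y i j 0).
  rewrite /wsq.
  under [RHS]eq_bigr => j _ do rewrite dotE.
  rewrite exchange_big /=; apply: eq_bigr => i _.
  rewrite dotE mulr_sumr; apply: eq_bigr => j _.
  by rewrite mul_diag_mx !mxE -sw; ring.
rewrite !wsqE mulr_sumr; apply: ler_sum => j _.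
have -> : \col_i mix A X i j 0 = A *m \col_i X i j 0.
  apply/colP => i; rewrite !mxE summxE; apply: eq_bigr => k _.
  by rewrite !mxE.
have -> : diag_mx s *m (A *m \col_i X i j 0) =
    B *m (diag_mx s *m \col_i X i j 0).
  by rewrite /B -!mulmxA (mulmxA (diag_mx s')) s's mul1mx.
rewrite -!sqr_enorm -exprMn ler_pXn2r ?nnegrE ?enorm_ge0 ?enorm_mulmx//.
exact: le_trans (enorm_ge0 _) (enorm_mulmx _ _).
Qed.

End Weighted.

Section Blocks.
Variables (K : realType) (n m : nat).
Implicit Types (x y : 'cV[K]_(n * m)).

Lemma blkD x y i : blk (x + y) i = blk x i + blk y i.
Proof. by apply/colP => j; rewrite !mxE. Qed.

Lemma blkN x i : blk (- x) i = - blk x i.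
Proof. by apply/colP => j; rewrite !mxE. Qed.

Lemma blkZ a x i : blk (a *: x) i = a *: blk x i.
Proof. by apply/colP => j; rewrite !mxE. Qed.

Lemma sum_mxtens (F : 'I_(n * m) -> K) :
  \sum_k F k = \sum_i \sum_j F (mxtens_index (i, j)).
Proof.
rewrite pair_bigA /= (reindex (@mxtens_index n m))/=; last first.
  by exists (@mxtens_unindex n m) => k _; rewrite (mxtens_indexK, mxtens_unindexK).
by apply: eq_bigr => -[i j].
Qed.

Lemma blk_kronI (A : 'M[K]_n) x i : blk (kronI m A *m x) i = mix A (blk x) i.
Proof.
apply/colP => j; rewrite !mxE summxE sum_mxtens; apply: eq_bigr => k _.
rewrite (bigD1 j)//= big1 ?addr0; last first.
  move=> l lj; rewrite /kronI tensmxE [1%:M j l]mxE eq_sym (negbTE lj).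
  by rewrite mulr0 mul0r.
by rewrite /kronI tensmxE [1%:M j j]mxE eqxx mulr1 !mxE.
Qed.

Lemma nsq_blk x : nsq x = \sum_i nsq (blk x i).
Proof.
rewrite dotE sum_mxtens; apply: eq_bigr => i _; rewrite dotE.
by apply: eq_bigr => j _; rewrite !mxE.
Qed.

Lemma kronI_diag (s : 'rV[K]_n) x i : mix (diag_mx s) (blk x) i = s 0 i *: blk x i.
Proof.
rewrite /mix (bigD1 i)//= big1 ?addr0 ?mxE ?eqxx ?mulr1n// => j ji.
by rewrite !mxE eq_sym (negbTE ji) mulr0n scale0r.
Qed.

Lemma nsq_kronI_diag (s : 'rV[K]_n) x :
  nsq (kronI m (diag_mx s) *m x) = wsq (fun i => s 0 i ^+ 2) (blk x).
Proof.
by rewrite nsq_blk; apply: eq_bigr => i _; rewrite blk_kronI kronI_diag nsqZ.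
Qed.

End Blocks.

(** * Directional derivatives and gradients *)

Section Gradients.
Variable K : realType.

(** A directional derivative only depends on the restriction to a line. *)
Lemma is_derive_line (p : nat) (U : 'cV[K]_p -> K) (w v : 'cV[K]_p) l :
  is_derive (0 : K) 1 (fun h : K => U (h *: v + w)) l -> is_derive w v U l.
Proof.
move=> [ex val].
have dU : derivable U w v by exact/derivable1P.
have E : (fun h : K => h^-1 *: (U (h *: v + w) - U w)) =
    (fun h : K => h^-1 *: (U ((h *: 1 + 0) *: v + w) - U (0 *: v + w))).
  by apply/funext => h; rewrite addr0 scale0r add0r [_%:A]mulr1.
by split=> //; rewrite -val /derive /comp /shift /= E.
Qed.

Lemma derive_gradE (p : nat) (U : 'cV[K]_p -> K) (w v : 'cV[K]_p) :
  differentiable U w -> 'D_v U w = dot (grad U w) v.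
Proof.
move=> dU; rewrite deriveE//.
have {1}-> : v = \sum_j v j 0 *: delta_mx j 0.
  by rewrite [LHS]matrix_sum_delta; apply: eq_bigr => j _; rewrite big_ord1.
rewrite linear_sum dotE; apply: eq_bigr => j _.
by rewrite linearZ /= mxE deriveE// mulrC.
Qed.

Lemma is_derive_along (p : nat) (U : 'cV[K]_p -> K) (v w : 'cV[K]_p) (t : K) :
  (forall u, differentiable U u) ->
  is_derive t 1 (fun h : K => U (h *: v + w)) (dot (grad U (t *: v + w)) v).
Proof.
move=> dU; rewrite -derive_gradE//.
have [ex val] := derivableP (diff_derivable (v := v) (dU (t *: v + w))).
have E : (fun h : K => h^-1 *: (U ((h *: 1 + t) *: v + w) - U (t *: v + w))) =
    (fun h : K => h^-1 *: (U (h *: v + (t *: v + w)) - U (t *: v + w))).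
  by apply/funext => h; rewrite [_%:A]mulr1 scalerDl addrA.
by apply: DeriveDef; rewrite /derivable /derive /comp /shift/= E.
Qed.

(** The quadratic upper bound for functions with Lipschitz gradient: along the
    segment, [F] minus the bound has a nonpositive derivative. *)
Lemma descent_lemma (p : nat) (F : 'cV[K]_p -> K) (LF : K) (u v : 'cV[K]_p) :
  (forall w, differentiable F w) -> is_lipschitz LF (grad F) ->
  F (v + u) <= F u + dot (grad F u) v + LF / 2 * nsq v.
Proof.
move=> dF lF.
pose D (t : K) := dot (grad F (t *: v + u)) v - dot (grad F u) v - LF * nsq v * t.
pose g (t : K) := F (t *: v + u) - dot (grad F u) v * t - LF / 2 * nsq v * t ^+ 2.
have dg (t : K) : is_derive t 1 g (D t).
  have dF' := is_derive_along v u t dF.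
  pose h1 : K -> K := fun s => F (s *: v + u).
  have {}dF' : is_derive t 1 h1 (dot (grad F (t *: v + u)) v) by exact: dF'.
  have -> : g = h1 - (dot (grad F u) v *: id)
      - ((LF / 2 * nsq v) *: (id ^+ 2 : K -> K)).
    by apply/funext => s; rewrite /g /h1 !fctE.
  apply: is_derive_eq; rewrite /D.
  rewrite /GRing.scale/= expr1; lra.
have cg : {within `[0, 1], continuous g}.
  apply: continuous_subspaceT => t.
  by apply: differentiable_continuous; apply/derivable1_diffP; exact: ex_derive.
have [t] := MVT ltr01 (fun s _ => dg s) cg.
rewrite in_itv /= => /andP[t0 t1].
have Dt : D t <= 0.
  rewrite /D.
  have := le_trans (ler_norm _) (dot_le (grad F (t *: v + u) - grad F u) v).
  have := ler_wpM2r (enorm_ge0 v) (lF (t *: v + u) u).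
  rewrite addrK enormZ (gtr0_norm t0) -[nsq v]sqr_enorm.
  have -> : LF * (t * enorm v) * enorm v = LF * enorm v ^+ 2 * t by ring.
  rewrite dotDl dotNl; lra.
rewrite subr0 mulr1 => gE; move: Dt; rewrite -gE /g.
rewrite scale1r scale0r add0r expr0n/= !mulr0 expr1n !mulr1; lra.
Qed.

Lemma is_Ck_differentiable (p k : nat) (U : 'cV[K]_p -> K) :
  is_Ck k.+1 U -> forall w, differentiable U w.
Proof. by case. Qed.

Section Separable.
Variables (n m : nat) (f : 'I_n -> 'cV[K]_m -> K).
Hypothesis df : forall i w, differentiable (f i) w.

Lemma Fsum_differentiable w : differentiable (Fsum f) w.
Proof.
have -> : Fsum f = \sum_i f i by apply/funext => v; rewrite /Fsum fct_sumE.
by apply: differentiable_sum.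
Qed.

Lemma grad_Fsum w : grad (Fsum f) w = \sum_i grad (f i) w.
Proof.
apply/colP => j; rewrite summxE mxE.
have -> : Fsum f = \sum_i f i by apply/funext => v; rewrite /Fsum fct_sumE.
rewrite derive_sum; last by move=> i; exact: diff_derivable.
by apply: eq_bigr => i _; rewrite mxE.
Qed.

(** Along a basis vector of block [i], only the summand [f i] varies. *)
Lemma blk_grad_Fc (x : 'cV[K]_(n * m)) i :
  blk (grad (Fc f) x) i = grad (f i) (blk x i).
Proof.
apply/colP => j; rewrite !mxE; set e := delta_mx _ _.
have ek k : blk e k = if k == i then delta_mx j 0 else 0.
  apply/colP => l; rewrite !mxE andbT (can_eq (@mxtens_indexK n m)) xpair_eqE.
  by case: (k == i); rewrite !mxE ?andbT.
pose g k (h : K) := f k (h *: blk e k + blk x k).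
have dFc : is_derive x e (Fc f) (\sum_k dot (grad (f k) (blk x k)) (blk e k)).
  apply: is_derive_line.
  have -> : (fun h : K => Fc f (h *: e + x)) = \sum_k g k.
    apply/funext => h; rewrite fct_sumE; apply: eq_bigr => k _.
    by rewrite /g blkD blkZ.
  apply: is_derive_sum => k.
  have := is_derive_along (blk e k) (blk x k) 0 (df k).
  by rewrite scale0r add0r.
have [_ ->] := dFc.
rewrite (bigD1 i)//= big1 ?addr0; last first.
  by move=> k /negbTE ki; rewrite ek ki -(scale0r (0 : 'cV[K]_m)) dotZr mul0r.
by rewrite ek eqxx -derive_gradE.
Qed.

End Separable.
End Gradients.

(** * Convergence of vector sequences *)

Section VectorConvergence.
Variable K : realType.

(** Entrywise convergence; it is the form that algebraic operations preserve by
    the scalar limit theorems. *)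
Definition vcvg (p : nat) (u : nat -> 'cV[K]_p) (l : 'cV[K]_p) : Prop :=
  forall i, (fun nu => u nu i 0) @ \oo --> l i 0.

Lemma cvg_vcvg (p : nat) (u : nat -> 'cV[K]_p) l : u @ \oo --> l -> vcvg u l.
Proof.
move=> ul i.
exact: (cvg_comp _ _ ul (@coord_continuous _ p 1 i 0 l)).
Qed.

Lemma vcvg_cvg (p : nat) (u : nat -> 'cV[K]_p) l : vcvg u l -> u @ \oo --> l.
Proof.
move=> ul; apply/cvgrPdist_le => /= e e0; near=> nu.
rewrite [leLHS]/Num.Def.normr/= mx_normrE (bigmax_le _ (ltW e0))//= => -[i j] _.
rewrite !mxE /= (ord1 j).
move: i {j}; near: nu; apply: filter_forall => /= i.
by have /cvgrPdist_le := ul i; apply.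
Unshelve. all: by end_near. Qed.

Lemma vcvg_cst (p : nat) (l : 'cV[K]_p) : vcvg (fun=> l) l.
Proof. by move=> i; exact: cvg_cst. Qed.

Lemma vcvgB (p : nat) (u v : nat -> 'cV[K]_p) k l :
  vcvg u k -> vcvg v l -> vcvg (fun nu => u nu - v nu) (k - l).
Proof.
move=> uk vl i; rewrite !mxE.
under eq_fun do rewrite !mxE.
exact: cvgB.
Qed.

Lemma vcvgZ (p : nat) (u : nat -> 'cV[K]_p) l a :
  vcvg u l -> vcvg (fun nu => a *: u nu) (a *: l).
Proof.
move=> ul i; rewrite !mxE; under eq_fun do rewrite !mxE.
exact: cvgMr.
Qed.

Lemma cvg_bigsum (I : finType) (a : I -> nat -> K) (b : I -> K) :
  (forall i, a i @ \oo --> b i) ->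
  (fun nu => \sum_i a i nu) @ \oo --> \sum_i b i.
Proof.
move=> ab; elim: (index_enum I) => [|i s IH].
  by rewrite big_nil; under eq_fun do rewrite big_nil; exact: cvg_cst.
by rewrite big_cons; under eq_fun do rewrite big_cons; exact: cvgD.
Qed.

Lemma vcvg_sum (p : nat) (I : finType) (u : I -> nat -> 'cV[K]_p) l :
  (forall i, vcvg (u i) (l i)) ->
  vcvg (fun nu => \sum_i u i nu) (\sum_i l i).
Proof.
move=> ul j; rewrite summxE; under eq_fun do rewrite summxE.
by apply: cvg_bigsum => i; exact: ul.
Qed.

Lemma cvg_dot (p : nat) (u v : nat -> 'cV[K]_p) k l :
  vcvg u k -> vcvg v l -> (fun nu => dot (u nu) (v nu)) @ \oo --> dot k l.
Proof.
move=> uk vl; rewrite dotE; under eq_fun do rewrite dotE.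
by apply: cvg_bigsum => i; exact: cvgM.
Qed.

Lemma vcvg_blk (n m : nat) (u : nat -> 'cV[K]_(n * m)) l i :
  vcvg u l -> vcvg (fun nu => blk (u nu) i) (blk l i).
Proof. by move=> ul j; rewrite mxE; under eq_fun do rewrite mxE; exact: ul. Qed.

(** A bound on distances passes to the limit, by continuity of [dot]. *)
Lemma enorm_lim_le (p : nat) (u : nat -> 'cV[K]_p) (v l : 'cV[K]_p) (b : K) :
  vcvg u l -> (\forall nu \near \oo, enorm (v - u nu) <= b) ->
  enorm (v - l) <= b.
Proof.
move=> ul ub.
have b0 : 0 <= b.
  have [N _ /(_ N (leqnn N))] := ub; exact: le_trans (enorm_ge0 _).
rewrite -(ler_pXn2r (_ : 0 < 2)%N) ?nnegrE ?enorm_ge0// sqr_enorm.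
have vu := vcvgB (@vcvg_cst _ v) ul.
apply: (cvgr_to_le (cvg_dot vu vu)).
apply: filterS ub => nu h.
by rewrite -sqr_enorm ler_pXn2r ?nnegrE ?enorm_ge0.
Qed.

End VectorConvergence.

(** * The merit function in blocks *)

Section WeightedInner.
Variables (K : realType) (n m : nat).
Implicit Types (w : 'I_n -> K) (X Y : 'I_n -> 'cV[K]_m).

Definition wdot w X Y : K := \sum_i w i * dot (X i) (Y i).

Lemma wsq_line w X E h :
  wsq w (fun i => h *: E i + X i) = wsq w X + 2 * wdot w X E * h + wsq w E * h ^+ 2.
Proof.
rewrite /wsq /wdot mulr_sumr !mulr_suml -!big_split /=; apply: eq_bigr => i _.
by rewrite nsqD nsqZ dotZl (dotC (E i) (X i)); ring.
Qed.

(** Cauchy-Schwarz for weighted families, from the one for the vectors of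
    weighted block norms. *)
Lemma wdot_le w X Y : (forall i, 0 <= w i) ->
  `|wdot w X Y| <= Num.sqrt (wsq w X) * Num.sqrt (wsq w Y).
Proof.
move=> w0.
pose col (Z : 'I_n -> 'cV[K]_m) : 'cV[K]_n := \col_i (Num.sqrt (w i) * enorm (Z i)).
have colE Z : enorm (col Z) = Num.sqrt (wsq w Z).
  rewrite enormE dotE; congr Num.sqrt; apply: eq_bigr => i _.
  by rewrite !mxE -expr2 exprMn sqr_sqrtr// sqr_enorm.
rewrite -!colE; apply: le_trans (le_trans (ler_norm _) (dot_le (col X) (col Y))).
rewrite dotE; apply: le_trans (ler_norm_sum _ _ _) _; apply: ler_sum => i _.
rewrite !mxE normrM ger0_norm// mulrACA -expr2 sqr_sqrtr//.
by rewrite ler_wpM2l// dot_le.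
Qed.

End WeightedInner.

Lemma is_derive_quadratic (K : realType) (a b e : K) :
  is_derive (0 : K) 1 (fun h : K => a + b * h + e * h ^+ 2) b.
Proof.
have d1 : is_derive (0 : K) (1 : K) (b *: (id : K -> K)) b.
  by apply: is_derive_eq; rewrite [LHS]mulr1.
have d2 : is_derive (0 : K) (1 : K) (e *: (id ^+ 2 : K -> K)) 0.
  by apply: is_derive_eq; rewrite /GRing.scale /= expr1 mulr0 mul0r mulr0.
have d0 : is_derive (0 : K) (1 : K) (cst a : K -> K) 0 by exact: is_derive_cst.
have h := is_deriveD (is_deriveD d0 d1) d2.
by rewrite add0r addr0 in h.
Qed.

Lemma diag_mulV (K : realType) (n : nat) (s : 'rV[K]_n) :
  (forall i, s 0 i != 0) ->
  diag_mx (\row_i (s 0 i)^-1) *m diag_mx s = 1%:M.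
Proof.
move=> s0; apply/matrixP => i j; rewrite mul_diag_mx !mxE.
by case: eqVneq => [->|_]; rewrite ?mulr1n ?mulVf// !mulr0n mulr0.
Qed.

Lemma invmx_diag (K : realType) (n : nat) (s : 'rV[K]_n) :
  (forall i, s 0 i != 0) -> invmx (diag_mx s) = diag_mx (\row_i (s 0 i)^-1).
Proof.
move=> /diag_mulV h; have [_ su] := mulmx1_unit h.
by rewrite -[LHS]mul1mx -h mulmxK.
Qed.

Section Merit.
Variables (K : realType) (n m : nat) (r c : 'cV[K]_n).
Implicit Types (X Y : 'I_n -> 'cV[K]_m).

(** The blocks of [(1%:M - JR m r) *m x]. *)
Definition xdev X i : 'cV[K]_m := X i - wmean (fun k => r k 0) X.

(** The blocks of [(1%:M - JC m c) *m y]. *)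
Definition ydev Y i : 'cV[K]_m := Y i - c i 0 *: \sum_k Y k.

Definition xgap X : K := wsq (fun i => r i 0) (xdev X).
Definition ygap Y : K := wsq (fun i => (c i 0)^-1) (ydev Y).

Lemma wmean_line w (h : K) X Y :
  wmean w (fun i => h *: Y i + X i) = h *: wmean w Y + wmean w X.
Proof.
rewrite /wmean scaler_sumr -big_split /=; apply: eq_bigr => i _.
by rewrite scalerDr !scalerA mulrC.
Qed.

Lemma xdev_line (h : K) X Y i :
  xdev (fun i => h *: Y i + X i) i = h *: xdev Y i + xdev X i.
Proof. by rewrite /xdev wmean_line scalerBr opprD addrACA. Qed.

Lemma ydev_line (h : K) X Y i :
  ydev (fun i => h *: Y i + X i) i = h *: ydev Y i + ydev X i.
Proof.
rewrite /ydev big_split /= -scaler_sumr scalerDr scalerA mulrC -scalerA.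
by rewrite scalerBr opprD addrACA.
Qed.

Hypothesis r_gt0 : forall i, 0 < r i 0.
Hypothesis c_gt0 : forall i, 0 < c i 0.

Lemma invmx_dsqrt : invmx (dsqrt c) = diag_mx (\row_i (Num.sqrt (c i 0))^-1).
Proof.
rewrite /dsqrt invmx_diag; last by move=> i; rewrite mxE gt_eqF// sqrtr_gt0.
by congr diag_mx; apply/rowP => i; rewrite !mxE.
Qed.

Lemma blk_JR (x : 'cV[K]_(n * m)) i :
  blk (JR m r *m x) i = wmean (fun k => r k 0) (blk x).
Proof.
rewrite /JR blk_kronI; apply: eq_bigr => j _.
by rewrite mxE big_ord1 !mxE mul1r.
Qed.

Lemma blk_JC (y : 'cV[K]_(n * m)) i :
  blk (JC m c *m y) i = c i 0 *: \sum_k blk y k.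
Proof.
rewrite /JC blk_kronI scaler_sumr; apply: eq_bigr => j _.
by rewrite mxE big_ord1 !mxE mulr1.
Qed.

Lemma meritE (f : 'I_n -> 'cV[K]_m -> K) kappa x y :
  merit f r c kappa x y = Fsum f (wmean (fun k => r k 0) (blk x))
    + xgap (blk x) + kappa * ygap (blk y).
Proof.
rewrite /merit; congr (_ + _ + _ * _).
- by apply: eq_bigr => i _; rewrite blk_JR.
- rewrite /normR sqr_enorm nsq_kronI_diag; apply: eq_bigr => i _.
  rewrite mxE sqr_sqrtr ?(ltW (r_gt0 _))//.
  by rewrite mulmxBl mul1mx blkD blkN blk_JR.
- rewrite /normC sqr_enorm invmx_dsqrt nsq_kronI_diag; apply: eq_bigr => i _.
  rewrite mxE exprVn sqr_sqrtr ?(ltW (c_gt0 _))//.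
  by rewrite mulmxBl mul1mx blkD blkN blk_JC.
Qed.

Variables (f : 'I_n -> 'cV[K]_m -> K) (kappa : K).
Hypothesis df : forall i w, differentiable (f i) w.
Hypothesis kappa_ge0 : 0 <= kappa.

Notation U := (fun w => merit f r c kappa (usubmx w) (dsubmx w)).
Notation mean := (wmean (fun k => r k 0)).

(** On a line the merit function is the objective plus a quadratic polynomial. *)
Lemma derive_merit (w v : 'cV[K]_(n * m + n * m)) :
  let X := blk (usubmx w) in let Y := blk (dsubmx w) in
  let X' := blk (usubmx v) in let Y' := blk (dsubmx v) in
  'D_v U w = dot (grad (Fsum f) (mean X)) (mean X')
    + 2 * wdot (fun i => r i 0) (xdev X) (xdev X')
    + kappa * (2 * wdot (fun i => (c i 0)^-1) (ydev Y) (ydev Y')).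
Proof.
move=> X Y X' Y'.
apply: derive_val; apply: is_derive_line.
have blkL h (s t : 'cV[K]_(n * m)) :
    blk (h *: s + t) = (fun i => h *: blk s i + blk t i).
  by apply/funext => i; rewrite blkD blkZ.
pose g (h : K) := Fsum f (h *: mean X' + mean X).
have dg : is_derive (0 : K) 1 g (dot (grad (Fsum f) (mean X)) (mean X')).
  have := is_derive_along (mean X') (mean X) 0 (Fsum_differentiable df).
  by rewrite scale0r add0r.
pose qr := wsq (fun i => r i 0) (xdev X').
pose qc := wsq (fun i => (c i 0)^-1) (ydev Y').
pose lr := 2 * wdot (fun i => r i 0) (xdev X) (xdev X').
pose lc := 2 * wdot (fun i => (c i 0)^-1) (ydev Y) (ydev Y').
have -> : (fun h : K => U (h *: v + w)) =
    g + (fun h => xgap X + kappa * ygap Y + (lr + kappa * lc) * h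
          + (qr + kappa * qc) * h ^+ 2).
  apply/funext => h; rewrite !fctE meritE !linearP /= !blkL.
  rewrite -/X -/Y -/X' -/Y' wmean_line /xgap /ygap.
  have -> : xdev (fun i => h *: X' i + X i) = (fun i => h *: xdev X' i + xdev X i).
    by apply/funext => i; exact: xdev_line.
  have -> : ydev (fun i => h *: Y' i + Y i) = (fun i => h *: ydev Y' i + ydev Y i).
    by apply/funext => i; exact: ydev_line.
  rewrite !wsq_line -/qr -/qc -/lr -/lc /g; ring.
rewrite -addrA; apply: is_deriveD; exact: is_derive_quadratic.
Qed.

(** Cauchy-Schwarz bounds every partial derivative; the constant collects the
    norms of the basis vectors. *)
Lemma merit_grad_bound : exists2 M : K, 0 < M & forall w,
  enorm (grad U w) <= M * (enorm (grad (Fsum f) (mean (blk (usubmx w))))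
    + Num.sqrt (xgap (blk (usubmx w))) + Num.sqrt (ygap (blk (dsubmx w)))).
Proof.
have w1 i : 0 <= r i 0 by exact: ltW.
have w2 i : 0 <= (c i 0)^-1 by rewrite invr_ge0 ltW.
pose coef (v : 'cV[K]_(n * m + n * m)) := enorm (mean (blk (usubmx v)))
  + 2 * Num.sqrt (xgap (blk (usubmx v)))
  + 2 * kappa * Num.sqrt (ygap (blk (dsubmx v))).
have coef0 v : 0 <= coef v.
  by rewrite !addr_ge0 ?enorm_ge0// !mulr_ge0// sqrtr_ge0.
pose S := \sum_i coef (delta_mx i 0) ^+ 2.
have S0 : 0 <= S by apply: sumr_ge0 => i _; exact: sqr_ge0.
exists (Num.sqrt S + 1); first by rewrite ltr_wpDl// sqrtr_ge0.
move=> w; set G := enorm (grad (Fsum f) _); set A := Num.sqrt (xgap _).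
set B := Num.sqrt (ygap _).
have GAB0 : 0 <= G + A + B by rewrite !addr_ge0 ?sqrtr_ge0 ?enorm_ge0.
apply: (@le_trans _ _ (Num.sqrt S * (G + A + B))); last first.
  by rewrite ler_wpM2r// lerDl.
rewrite -{1}[G + A + B]ger0_norm// -sqrtr_sqr -sqrtrM//.
apply: enorm_le_sqrt; rewrite dotE mulr_suml; apply: ler_sum => i _.
rewrite -expr2 -exprMn -[leLHS]real_normK ?num_real//.
rewrite ler_pXn2r ?nnegrE ?mulr_ge0//; last first.
rewrite mxE derive_merit; set v := delta_mx i 0; rewrite /coef.
set m' := enorm (mean _); set A' := Num.sqrt (xgap (blk (usubmx v))).
set B' := Num.sqrt (ygap (blk (dsubmx v))).
have h1 := dot_le (grad (Fsum f) (mean (blk (usubmx w)))) (mean (blk (usubmx v))).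
have h2 := wdot_le (xdev (blk (usubmx w))) (xdev (blk (usubmx v))) w1.
have h3 := wdot_le (ydev (blk (dsubmx w))) (ydev (blk (dsubmx v))) w2.
rewrite -/G -/m' in h1; rewrite -!/(xgap _) -/A -/A' in h2.
rewrite -!/(ygap _) -/B -/B' in h3.
have G0 : 0 <= G by exact: enorm_ge0.
have m0 : 0 <= m' by exact: enorm_ge0.
have A0 : 0 <= A by exact: sqrtr_ge0.
have A'0 : 0 <= A' by exact: sqrtr_ge0.
have B0 : 0 <= B by exact: sqrtr_ge0.
have B'0 : 0 <= B' by exact: sqrtr_ge0.
have kB := mulr_ge0 kappa_ge0 B'0.
apply: le_trans (ler_normD _ _) _; rewrite normrM (ger0_norm kappa_ge0).
rewrite !normrM (ger0_norm (_ : 0 <= 2))//.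
apply: le_trans (lerD (ler_normD _ _) (lexx _)) _.
rewrite normrM (ger0_norm (_ : 0 <= 2))//.
have h3' := ler_wpM2l kappa_ge0 h3.
have := mulr_ge0 m0 A0; have := mulr_ge0 m0 B0.
have := mulr_ge0 A'0 G0; have := mulr_ge0 A'0 B0.
have := mulr_ge0 kB G0; have := mulr_ge0 kB A0.
lra.
Qed.

Lemma merit_cvg (z : nat -> 'cV[K]_(n * m + n * m)) (l : 'cV[K]_(n * m + n * m)) :
  z @ \oo --> l -> (fun nu => U (z nu)) @ \oo --> U l.
Proof.
move=> /cvg_vcvg zl.
have ul : vcvg (fun nu => usubmx (z nu)) (usubmx l).
  by move=> i; rewrite mxE; under eq_fun do rewrite mxE; exact: zl.
have dl : vcvg (fun nu => dsubmx (z nu)) (dsubmx l).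
  by move=> i; rewrite mxE; under eq_fun do rewrite mxE; exact: zl.
have ml : vcvg (fun nu => mean (blk (usubmx (z nu)))) (mean (blk (usubmx l))).
  by apply: vcvg_sum => i; apply: vcvgZ; exact: vcvg_blk.
rewrite meritE; under eq_fun do rewrite meritE.
apply: cvgD; first apply: cvgD.
- apply: (cvg_comp _ _ (vcvg_cvg ml)).
  exact/differentiable_continuous/Fsum_differentiable.
- apply: cvg_bigsum => i; apply: cvgMr.
  by apply: cvg_dot; apply: vcvgB => //; exact: vcvg_blk.
- apply: cvgMr; apply: cvg_bigsum => i; apply: cvgMr.
  apply: cvg_dot; (apply: vcvgB; first exact: vcvg_blk);
  by apply: vcvgZ; apply: vcvg_sum => k; exact: vcvg_blk.
Qed.

End Merit.

(** * One step of the iteration *)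

Section Extremes.
Variables (K : realType) (n : nat) (v : 'cV[K]_n).
Hypothesis v_gt0 : forall i, 0 < v i 0.
Hypothesis v_sum : \sum_i v i 0 = 1.

Lemma stoch_le1 i : v i 0 <= 1.
Proof. by rewrite -v_sum (bigD1 i)//= lerDl sumr_ge0// => j _; exact: ltW. Qed.

Lemma vmin_gt0 : 0 < vmin v.
Proof. by apply: lt_bigmin => // i _; exact: v_gt0. Qed.

Lemma vmin_le i : vmin v <= v i 0.
Proof. exact: (@bigmin_le _ K _ 1 i (fun i => v i 0)). Qed.

Lemma vmin_le1 : vmin v <= 1.
Proof. exact: bigmin_le_id. Qed.

Lemma vmax_ge i : v i 0 <= vmax v.
Proof. exact: (@le_bigmax _ K _ 0 (fun i => v i 0)). Qed.

Lemma vmax_ge0 : 0 <= vmax v.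
Proof. exact: bigmax_ge_id. Qed.

Lemma sqr_inv_sqrt_vmin : (1 / Num.sqrt (vmin v)) ^+ 2 = (vmin v)^-1.
Proof. by rewrite div1r exprVn sqr_sqrtr// ltW// vmin_gt0. Qed.

Lemma sqr_sqrt_vmax : Num.sqrt (vmax v) ^+ 2 = vmax v.
Proof. by rewrite sqr_sqrtr// vmax_ge0. Qed.

Lemma wsq1_le_vmin (m : nat) (X : 'I_n -> 'cV[K]_m) :
  wsq (fun=> 1) X <= (vmin v)^-1 * wsq (fun i => v i 0) X.
Proof.
rewrite -wsqZl; apply: ler_wsq => i; rewrite ler_wpM2r ?nsq_ge0//.
by rewrite ler_pdivlMl ?vmin_gt0// mulr1 vmin_le.
Qed.

Lemma wsqV_le_vmin (m : nat) (X : 'I_n -> 'cV[K]_m) :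
  wsq (fun i => (v i 0)^-1) X <= (vmin v)^-1 * wsq (fun=> 1) X.
Proof.
rewrite -wsqZl; apply: ler_wsq => i; rewrite ler_wpM2r ?nsq_ge0// mulr1.
by rewrite lef_pV2 ?posrE ?vmin_gt0 ?v_gt0 ?vmin_le.
Qed.

Lemma wsq1_le_vmax (m : nat) (X : 'I_n -> 'cV[K]_m) :
  wsq (fun=> 1) X <= vmax v * wsq (fun i => (v i 0)^-1) X.
Proof.
rewrite -wsqZl; apply: ler_wsq => i; rewrite ler_wpM2r ?nsq_ge0//.
by rewrite ler_pdivlMr// mul1r vmax_ge.
Qed.

End Extremes.

(** The sum of all blocks is controlled by Cauchy-Schwarz, here in the form of
    the variance formula for uniform weights. *)
Lemma nsq_sum_le (K : realType) (n m : nat) (X : 'I_n -> 'cV[K]_m) :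
  nsq (\sum_i X i) <= n%:R * wsq (fun=> 1) X.
Proof.
case: n X => [|n] X; first by rewrite big_ord0 nsq0 mul0r.
have n0 : (n.+1%:R : K) != 0 by rewrite pnatr_eq0.
have n1 : \sum_(i < n.+1) (n.+1%:R^-1 : K) = 1.
  by rewrite sumr_const card_ord -[LHS]mulr_natl mulfV.
have n2 (i : 'I_n.+1) : 0 <= (n.+1%:R^-1 : K) by rewrite invr_ge0.
have := nsq_wmean_le X n1 n2; rewrite /wmean -scaler_sumr nsqZ.
have -> : wsq (fun=> n.+1%:R^-1) X = n.+1%:R^-1 * wsq (fun=> 1) X.
  by rewrite -wsqZl; apply: eq_bigr => i _; rewrite mulr1.
move: (nsq _) (wsq _ _) => A B /(ler_wpM2l (sqr_ge0 n.+1%:R)).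
rewrite mulrA -exprMn mulfV// expr1n mul1r.
by rewrite [n.+1%:R ^+ 2 * _]mulrA expr2 mulfK.
Qed.

Section Dynamics.
Variables (K : realType) (n m : nat) (R C : 'M[K]_n) (r c : 'cV[K]_n).
Hypothesis r_gt0 : forall i, 0 < r i 0.
Hypothesis c_gt0 : forall i, 0 < c i 0.
Hypothesis r_sum : \sum_i r i 0 = 1.
Hypothesis c_sum : \sum_i c i 0 = 1.
Hypothesis R_row : forall i, \sum_j R i j = 1.
Hypothesis C_col : forall j, \sum_i C i j = 1.
Hypothesis rR : r^T *m R = r^T.
Hypothesis Cc : C *m c = c.
Implicit Types (X Y D : 'I_n -> 'cV[K]_m).

Notation rw := (fun i => r i 0).
Notation cw := (fun i => (c i 0)^-1).
Notation mean := (wmean rw).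

Let r_ge0 i : 0 <= r i 0. Proof. exact: ltW. Qed.
Let cV_ge0 i : 0 <= (c i 0)^-1. Proof. by rewrite invr_ge0 ltW. Qed.

Lemma mix_dist (A : 'M[K]_n) X Y i :
  mix A (fun j => X j - Y j) i = mix A X i - mix A Y i.
Proof.
by rewrite /mix -sumrB; apply: eq_bigr => j _; rewrite scalerBr.
Qed.

Lemma mixR_cst (u : 'cV[K]_m) i : mix R (fun=> u) i = u.
Proof. by rewrite /mix -scaler_suml R_row scale1r. Qed.

Lemma mixC_c (u : 'cV[K]_m) i : mix C (fun j => c j 0 *: u) i = c i 0 *: u.
Proof.
rewrite -[in RHS]Cc mxE scaler_suml; apply: eq_bigr => j _.
by rewrite scalerA.
Qed.

Lemma mean_mixR X : mean (mix R X) = mean X.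
Proof.
rewrite /wmean /mix; under eq_bigr => i _ do rewrite scaler_sumr.
rewrite exchange_big /=; apply: eq_bigr => j _.
under eq_bigr => i _ do rewrite scalerA.
rewrite -scaler_suml; congr (_ *: _).
have /rowP/(_ j) := rR; rewrite !mxE => <-.
by apply: eq_bigr => i _; rewrite mxE.
Qed.

Lemma sum_mixC Y : \sum_i mix C Y i = \sum_i Y i.
Proof.
rewrite /mix exchange_big /=; apply: eq_bigr => j _.
by rewrite -scaler_suml C_col scale1r.
Qed.

Lemma mean_xdev X : mean (xdev r X) = 0.
Proof.
rewrite /wmean /xdev; under eq_bigr => i _ do rewrite scalerBr.
by rewrite sumrB -scaler_suml r_sum scale1r subrr.
Qed.

Lemma sum_ydev Y : \sum_i ydev c Y i = 0.
Proof. by rewrite /ydev sumrB -scaler_suml c_sum scale1r subrr. Qed.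

Lemma mixR_contract X : mean X = 0 ->
  wsq rw (mix R X) <= rhoR R r ^+ 2 * wsq rw X.
Proof.
move=> X0.
have -> : mix R X = mix (R - ones K n *m r^T) X.
  apply/funext => i; rewrite -[LHS]subr0 -[X in _ - X]X0 /mix -sumrB.
  by apply: eq_bigr => j _; rewrite -scalerBl !mxE big_ord1 !mxE mul1r.
pose s := \row_i Num.sqrt (r i 0).
have s0 i : s 0 i != 0 by rewrite mxE gt_eqF// sqrtr_gt0.
rewrite /rhoR /dsqrt -/s invmx_diag//; apply: wsq_mix_le.
  by move=> i; rewrite mxE sqr_sqrtr.
exact: diag_mulV.
Qed.

Lemma mixC_contract Y : \sum_i Y i = 0 ->
  wsq cw (mix C Y) <= rhoC C c ^+ 2 * wsq cw Y.
Proof.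
move=> Y0.
have -> : mix C Y = mix (C - c *m (ones K n)^T) Y.
  apply/funext => i; rewrite -[LHS]subr0 -(scaler0 _ (c i 0)) -Y0 scaler_sumr.
  rewrite /mix -sumrB; apply: eq_bigr => j _.
  by rewrite -scalerBl !mxE big_ord1 !mxE mulr1.
rewrite /rhoC invmx_dsqrt//; apply: wsq_mix_le.
  by move=> i; rewrite mxE exprVn sqr_sqrtr// ltW.
have s0 i : (\row_i Num.sqrt (c i 0)) 0 i != 0.
  by rewrite mxE gt_eqF// sqrtr_gt0.
have := diag_mulV s0; rewrite /dsqrt => /mulmx1C <-; congr (_ *m diag_mx _).
by apply/rowP => i; rewrite !mxE.
Qed.

(** In the metric of [normC], [JC] is the orthogonal projection: after the
    substitution [D i = c i *: E i] this is centering with weights [c]. *)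
Lemma wsq_projC_le D : wsq cw (ydev c D) <= wsq cw D.
Proof.
pose E i := (c i 0)^-1 *: D i.
have c0 i : c i 0 != 0 by rewrite gt_eqF.
have DE i : D i = c i 0 *: E i by rewrite scalerA divff// scale1r.
have cE F : wsq cw (fun i => c i 0 *: F i) = wsq (fun i => c i 0) F.
  by apply: eq_bigr => i _; rewrite nsqZ mulrA expr2 mulrA mulVf// mul1r.
have -> : wsq cw D = wsq (fun i => c i 0) E.
  by rewrite -cE; apply: eq_bigr => i _; rewrite -DE.
apply: le_trans (wsq_center_le E c_sum); rewrite -cE.
rewrite le_eqVlt; apply/orP; left; apply/eqP/eq_bigr => i _.
have -> : ydev c D i = c i 0 *: (E i - wmean (fun i => c i 0) E) => //.
rewrite scalerBr -DE /ydev /wmean.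
by congr (_ - _ *: _); apply: eq_bigr => k _.
Qed.

Lemma zetaE : zeta r c = \sum_i r i 0 * c i 0.
Proof. by rewrite /zeta mxE; apply: eq_bigr => i _; rewrite mxE. Qed.

Lemma zeta_gt0 : (0 < n)%N -> 0 < zeta r c.
Proof.
move=> n0; rewrite zetaE (bigD1 (Ordinal n0))//= ltr_wpDr ?mulr_gt0//.
by rewrite sumr_ge0// => i _; rewrite mulr_ge0// ltW.
Qed.

Lemma zeta_le1 : zeta r c <= 1.
Proof.
rewrite zetaE -r_sum; apply: ler_sum => i _.
by rewrite ler_piMr// stoch_le1.
Qed.

(** The variance of a variable with values in [0, 1] is at most 1/4. *)
Lemma variance_c_le : \sum_i r i 0 * (c i 0 - zeta r c) ^+ 2 <= 1 / 4.
Proof.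
have -> : \sum_i r i 0 * (c i 0 - zeta r c) ^+ 2 =
    \sum_i r i 0 * c i 0 ^+ 2 - 2 * zeta r c * (\sum_i r i 0 * c i 0)
      + zeta r c ^+ 2 * \sum_i r i 0.
  rewrite !mulr_sumr -sumrN -!big_split /=; apply: eq_bigr => i _; ring.
have : \sum_i r i 0 * c i 0 ^+ 2 <= zeta r c.
  rewrite zetaE; apply: ler_sum => i _; rewrite ler_wpM2l// expr2.
  by rewrite ler_piMr ?stoch_le1// ltW.
rewrite -zetaE r_sum; have := sqr_ge0 (zeta r c - 1 / 2); lra.
Qed.

(** Since [r^T R = r^T] and the rows of [R] sum to 1, centering commutes with
    mixing, so the errors are contracted.  The part of [Y] proportional to [c]
    enters only through the variance of [c], whose bound 1/4 is doubled by the
    splitting. *)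
Lemma xgap_step t alpha X Y : 0 < t ->
  xgap r (fun i => mix R X i - alpha *: Y i) <=
  (1 + t) * (rhoR R r ^+ 2 * xgap r X) +
  (1 + t^-1) * (alpha ^+ 2 *
    (1 / 2 * nsq (\sum_i Y i) + 2 * (vmax r * vmax c * ygap c Y))).
Proof.
move=> t0; set ys := \sum_i Y i.
have devE : xdev r (fun i => mix R X i - alpha *: Y i) =
    (fun i => mix R (xdev r X) i - alpha *: xdev r Y i).
  apply/funext => i; rewrite /xdev mix_dist mixR_cst.
  have -> : mean (fun i => mix R X i - alpha *: Y i) = mean X - alpha *: mean Y.
    rewrite -[in RHS]mean_mixR /wmean scaler_sumr -sumrB; apply: eq_bigr => k _.
    by rewrite scalerBr !scalerA mulrC.
  rewrite scalerBr !opprB [LHS]addrACA [RHS]addrACA; congr (_ + _).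
  exact: addrC.
have YE : xdev r Y = (fun i => (c i 0 - zeta r c) *: ys + xdev r (ydev c Y) i).
  apply/funext => i; rewrite /xdev.
  have -> : mean (ydev c Y) = mean Y - zeta r c *: ys.
    rewrite zetaE scaler_suml -sumrB; apply: eq_bigr => k _.
    by rewrite /ydev scalerBr scalerA.
  rewrite /ydev -/ys scalerBl opprB [RHS]addrA.
  by rewrite [X in X + (_ - mean Y)]addrC !subrKA.
have Yle : wsq rw (xdev r Y) <=
    1 / 2 * nsq ys + 2 * (vmax r * vmax c * ygap c Y).
  rewrite YE; apply: le_trans (wsqD_young _ _ ltr01 r_ge0) _.
  have h1 : wsq rw (fun i => (c i 0 - zeta r c) *: ys) <= 1 / 4 * nsq ys.
    have -> : wsq rw (fun i => (c i 0 - zeta r c) *: ys) =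
        (\sum_i r i 0 * (c i 0 - zeta r c) ^+ 2) * nsq ys.
      by rewrite mulr_suml; apply: eq_bigr => i _; rewrite nsqZ mulrA.
    by rewrite ler_wpM2r ?nsq_ge0// variance_c_le.
  have h2 : wsq rw (xdev r (ydev c Y)) <= vmax r * vmax c * ygap c Y.
    apply: le_trans (wsq_center_le _ r_sum) _.
    rewrite -wsqZl; apply: ler_wsq => i; rewrite ler_wpM2r ?nsq_ge0//.
    rewrite ler_pdivlMr// ler_pM ?vmax_ge//; exact: ltW.
  rewrite invr1; lra.
rewrite /xgap devE; apply: le_trans (wsqB_young _ _ t0 r_ge0) _.
apply: lerD; first by rewrite ler_wpM2l ?mixR_contract ?mean_xdev//; lra.
rewrite wsqZr ler_wpM2l ?addr_ge0 ?invr_ge0 ?(ltW t0)//.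
by rewrite ler_wpM2l ?sqr_ge0.
Qed.

(** Since [C c = c] and the columns of [C] sum to 1, projecting commutes with
    mixing; the gradient increments [D] enter through an orthogonal projection,
    which shortens them. *)
Lemma ygap_step s Y D : 0 < s ->
  ygap c (fun i => mix C Y i + D i) <=
  (1 + s) * (rhoC C c ^+ 2 * ygap c Y) +
  (1 + s^-1) * ((vmin c)^-1 * wsq (fun=> 1) D).
Proof.
move=> s0.
have devE : ydev c (fun i => mix C Y i + D i) =
    (fun i => mix C (ydev c Y) i + ydev c D i).
  apply/funext => i; rewrite /ydev mix_dist mixC_c big_split /= sum_mixC.
  by rewrite scalerDr opprD addrACA.
rewrite /ygap devE; apply: le_trans (wsqD_young _ _ s0 cV_ge0) _.
apply: lerD; first by rewrite ler_wpM2l ?mixC_contract ?sum_ydev//; lra.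
rewrite ler_wpM2l ?addr_ge0 ?invr_ge0 ?(ltW s0)//.
exact: le_trans (wsq_projC_le D) (wsqV_le_vmin c_gt0 _).
Qed.

(** The weights 6/5 and 6 in the splitting leave room for the factor
    [(1 + rhoR) ^+ 2 <= 4] of the consensus error. *)
Lemma move_step alpha X Y : rhoR R r ^+ 2 <= 1 ->
  wsq (fun=> 1) (fun i => mix R X i - alpha *: Y i - X i) <=
  24 / 5 * ((vmin r)^-1 * xgap r X) +
  12 * (alpha ^+ 2 * (nsq (\sum_i Y i) + vmax c * ygap c Y)).
Proof.
move=> rho1; set ys := \sum_i Y i.
have -> : (fun i => mix R X i - alpha *: Y i - X i) =
   (fun i => (mix R (xdev r X) i - xdev r X i) -
             alpha *: (c i 0 *: ys + ydev c Y i)).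
  apply/funext => i; rewrite /xdev mix_dist mixR_cst /ydev -/ys subrKC.
  by rewrite opprB addrA subrK addrAC.
apply: le_trans (wsqB_young _ _ (_ : 0 < 1 / 5) (fun=> ler01)) _; first by lra.
have h1 : wsq (fun=> 1) (fun i => mix R (xdev r X) i - xdev r X i) <=
    4 * ((vmin r)^-1 * xgap r X).
  apply: le_trans (wsq1_le_vmin r_gt0 _) _.
  rewrite mulrCA ler_wpM2l ?invr_ge0 ?(ltW (vmin_gt0 r_gt0))//.
  apply: le_trans (wsqB_young _ _ ltr01 r_ge0) _.
  have := mixR_contract (mean_xdev X).
  have := ler_wpM2r (wsq_ge0 (xdev r X) r_ge0) rho1.
  rewrite /xgap invr1; lra.
have h2 : wsq (fun=> 1) (fun i => c i 0 *: ys + ydev c Y i) <=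
    2 * (nsq ys + vmax c * ygap c Y).
  apply: le_trans (wsqD_young _ _ ltr01 (fun=> ler01)) _.
  have e1 : wsq (fun=> 1) (fun i => c i 0 *: ys) <= nsq ys.
    have -> : wsq (fun=> 1) (fun i => c i 0 *: ys) = (\sum_i c i 0 ^+ 2) * nsq ys.
      by rewrite mulr_suml; apply: eq_bigr => i _; rewrite nsqZ mul1r.
    rewrite ler_piMl ?nsq_ge0// -[leRHS]c_sum; apply: ler_sum => i _.
    by rewrite expr2 ler_piMr ?stoch_le1// ltW.
  have := wsq1_le_vmax c_gt0 (ydev c Y).
  rewrite -/(ygap c Y) invr1; lra.
rewrite wsqZr.
have := ler_wpM2l (sqr_ge0 alpha) h2.
have -> : (1 / 5 : K)^-1 = 5 by rewrite div1r invrK.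
lra.
Qed.

Variables (f : 'I_n -> 'cV[K]_m -> K) (LF Lc : K).
Hypothesis df : forall i w, differentiable (f i) w.
Hypothesis f_lip : forall i, is_lipschitz Lc (grad (f i)).
Hypothesis F_lip : is_lipschitz LF (grad (Fsum f)).
Hypothesis LF_ge0 : 0 <= LF.

(** The tracked gradient is the gradient of the objective at the average, up to
    the consensus error. *)
Lemma grad_err X : nsq (grad (Fsum f) (mean X) - \sum_i grad (f i) (X i)) <=
  n%:R * Lc ^+ 2 * (vmin r)^-1 * xgap r X.
Proof.
rewrite grad_Fsum// -sumrB; apply: le_trans (nsq_sum_le _) _.
rewrite -[_ * _^-1 * _]mulrA -[n%:R * _ * _]mulrA ler_wpM2l//.
apply: (@le_trans _ _ (Lc ^+ 2 * wsq (fun=> 1) (xdev r X))).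
  rewrite -wsqZl; apply: ler_wsq => i; rewrite mul1r mulr1.
  apply: le_trans (lipschitz_sqr _ _ (f_lip i)) _.
  by rewrite -nsqN opprB.
by rewrite ler_wpM2l ?sqr_ge0//; exact: wsq1_le_vmin.
Qed.

(** The objective along the weighted average: the average moves by
    [- alpha] times [zeta] times the tracked gradient, up to the consensus and
    tracking errors. *)
Lemma objective_step (eps alpha : K) X Y : 0 < eps -> 0 < alpha -> (0 < n)%N ->
  \sum_i Y i = \sum_i grad (f i) (X i) ->
  Fsum f (mean (fun i => mix R X i - alpha *: Y i)) <=
  Fsum f (mean X)
  - alpha * (zeta r c - eps / 2 * (zeta r c + 1)) * nsq (\sum_i Y i)
  + alpha / 2 * (1 / eps + 1) * (vmax c * ygap c Y)
  + alpha / 2 * (1 + zeta r c / eps) * (n%:R * Lc ^+ 2 * (vmin r)^-1 * xgap r X)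
  + LF * alpha ^+ 2 * (zeta r c ^+ 2 * nsq (\sum_i Y i) + vmax c * ygap c Y).
Proof.
move=> eps0 alpha0 n0 track; set z := zeta r c.
set ys := \sum_i Y i; set p := mean (ydev c Y).
set G := grad (Fsum f) (mean X); set e := G - ys.
have z0 : 0 < z by exact: zeta_gt0.
have meanE : mean (fun i => mix R X i - alpha *: Y i) =
    - alpha *: (z *: ys + p) + mean X.
  have YE : mean Y = z *: ys + p.
    rewrite /z zetaE /p scaler_suml -big_split; apply: eq_bigr => k _ /=.
    by rewrite /ydev scalerBr scalerA subrKC.
  rewrite -YE -[in RHS](mean_mixR X) addrC scaleNr /wmean scaler_sumr -sumrB.
  by apply: eq_bigr => k _; rewrite scalerBr !scalerA mulrC.
rewrite meanE; apply: le_trans (descent_lemma _ _ (Fsum_differentiable df) F_lip) _.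
rewrite -/G nsqZ sqrrN dotZr.
have y4 := nsqD_young (z *: ys) p ltr01.
move: (nsq (z *: ys + p)) y4 => Q; rewrite nsqZ => y4.
have -> : G = ys + e by rewrite /e subrKC.
rewrite dotDl !dotDr !dotZr.
have en : nsq e <= n%:R * Lc ^+ 2 * (vmin r)^-1 * xgap r X.
  by rewrite /e /ys track grad_err.
have pn : nsq p <= vmax c * ygap c Y.
  apply: le_trans (nsq_wmean_le _ r_sum r_ge0) _; rewrite -wsqZl.
  apply: ler_wsq => i; rewrite ler_wpM2r ?nsq_ge0//.
  by rewrite ler_pdivlMr// -[leRHS]mul1r ler_pM ?stoch_le1 ?vmax_ge//; exact: ltW.
have y1 := dot_youngN ys p eps0.
have y2 := dot_youngN ys e eps0.
have y3 := dot_youngN e p ltr01.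
rewrite (dotC e ys) !invr1 in y3 y4 *.
move: y1 y2 y3 y4 en pn.
move: (nsq p) (nsq e) (nsq ys) (dot ys p) (dot ys e) (dot e p).
move: (n%:R * Lc ^+ 2 * (vmin r)^-1 * xgap r X) (vmax c * ygap c Y) (Fsum f _).
move=> E P F np ne g yp ye ep y1 y2 y3 y4 en pn.
have ie : 0 < eps^-1 by rewrite invr_gt0.
have a1 := ler_wpM2l (ltW alpha0) y1.
have a2 := ler_wpM2l (ltW (mulr_gt0 alpha0 z0)) y2.
have a3 := ler_wpM2l (ltW alpha0) y3.
have a4 := ler_wpM2l (mulr_ge0 LF_ge0 (sqr_ge0 alpha)) y4.
have b1 := ler_wpM2l (mulr_ge0 (ltW alpha0) (_ : 0 <= eps^-1 + 1)) pn.
have b2 := ler_wpM2l (mulr_ge0 (ltW alpha0) (_ : 0 <= 1 + z * eps^-1)) en.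
have b3 := ler_wpM2l (mulr_ge0 LF_ge0 (sqr_ge0 alpha)) pn.
have {}b1 := b1 (ltW (addr_gt0 ie ltr01)).
have {}b2 := b2 (ltW (addr_gt0 ltr01 (mulr_gt0 z0 ie))).
rewrite div1r; lra.
Qed.

End Dynamics.

(** * Descent of the merit function *)

(** Division by zero gives 0, so a positive number below [x / b] forces
    [b != 0]. *)
Lemma lt_divr_mul (K : realType) (a x b : K) :
  0 < a -> 0 <= b -> a < x / b -> a * b < x.
Proof.
move=> a0; rewrite le_eqVlt => /predU1P[<-|b0]; last by rewrite ltr_pdivlMr.
by rewrite invr0 mulr0 => /(lt_trans a0); rewrite ltxx.
Qed.

(** The coefficients of the consensus error, the tracking error and the tracked
    gradient in the change of the merit function are negative.  Here [q], [p],
    [mu], [kr] stand for the squares of [K2R], [KC2], [K2C], [KRC], and [rho],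
    [sig] for those of [rhoR], [rhoC].  The bound on [ka] says
    [3 w q <= rho ex], hence [24 / 5 * w q <= 8 / 5 * ex rho], which together
    with [2 / 5 * ex] makes the [2 ex] of the first step-size bound.  As
    [rho ex < 1 / 2], it also gives [12 w <= 2].  The third step-size bound gives
    [al <= 1 / 4], so that [12 al <= 3] and [al s <= 1 + 1 / ex] in the second
    coefficient. *)
Lemma stepsize_slack (K : realType)
    (n LF Lc q p mu kr z rho sig ex ey eps ka al : K) :
  2 <= n -> 0 <= LF -> 1 <= q -> 0 < p -> 0 <= mu -> 0 <= kr -> 0 < z <= 1 ->
  0 <= rho -> 0 < ex -> ex * (2 * rho) < 1 - rho -> 0 < ey -> 0 < eps ->
  0 < ka -> ka <= rho * ex / (3 * p * q * Lc ^+ 2 * (1 + 1 / ey)) -> 0 < al ->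
  al < 2 * (1 - rho * (1 + 2 * ex)) / (n * Lc ^+ 2 * q * (1 + z / eps)) ->
  al < (1 - sig * (1 + ey)) /
    (1 / (2 * ka) * mu * (1 + 1 / eps + 2 * LF) + 2 * kr * (1 + 1 / ex) / ka
     + 3 * p * mu * Lc ^+ 2 * (1 + 1 / ey)) ->
  al < (z - eps / 2 * (z + 1)) /
    (LF * z ^+ 2 + 2 * n * (1 + 1 / ex) + 3 * p * Lc ^+ 2 * ka) ->
  let w := ka * (1 + ey^-1) * p * Lc ^+ 2 in
  let s := 1 + (2 / 5 * ex)^-1 in
  [/\ al / 2 * (1 + z / eps) * (n * Lc ^+ 2 * q) + (1 + 2 / 5 * ex) * rho
        + 24 / 5 * (w * q) < 1,
      al / 2 * (1 / eps + 1) * mu + LF * al ^+ 2 * mu + s * al ^+ 2 * (2 * kr)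
        + ka * ((1 + ey) * sig) + 12 * (w * al ^+ 2 * mu) < ka &
      LF * al ^+ 2 * z ^+ 2 + s * al ^+ 2 * (1 / 2) + 12 * (w * al ^+ 2)
        < al * (z - eps / 2 * (z + 1))].
Proof.
move=> n2 LF0 q1 p0 mu0 kr0 /andP[z0 z1] rho0 ex0 exlt ey0 eps0 ka0 kale al0.
have q0 : 0 < q by lra.
have iex : 0 < ex^-1 by rewrite invr_gt0.
have iey : 0 < ey^-1 by rewrite invr_gt0.
have ieps : 0 < eps^-1 by rewrite invr_gt0.
have ika : 0 < ka^-1 by rewrite invr_gt0.
have Lc0 : 0 <= Lc ^+ 2 by exact: sqr_ge0.
have ey1 : 0 <= 1 + ey^-1 by lra.
have wq w : w = ka * (1 + ey^-1) * p * Lc ^+ 2 -> 3 * (w * q) <= rho * ex.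
  move=> ->; set M := 3 * p * q * _ * _ in kale.
  have M0 : 0 <= M.
    rewrite /M div1r; apply: mulr_ge0 ey1; apply: mulr_ge0 Lc0.
    by rewrite !mulr_ge0 ?(ltW p0) ?(ltW q0).
  have Mgt0 : 0 < M.
    rewrite lt_neqAle M0 andbT eq_sym; apply/eqP => Me.
    by move: (lt_le_trans ka0 kale); rewrite Me invr0 mulr0 ltxx.
  by move: kale; rewrite ler_pdivlMr// /M div1r; lra.
move=> h1 h2 h3 w s; have {}wq := wq w erefl.
have w0 : 0 <= w.
  by exact: mulr_ge0 (mulr_ge0 (mulr_ge0 (ltW ka0) ey1) (ltW p0)) Lc0.
have wE : ka * (3 * p * mu * Lc ^+ 2 * (1 + ey^-1)) = 3 * (w * mu).
  by rewrite /w; ring.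
have sE : s = 1 + 5 / 2 * ex^-1 by rewrite /s invfM invf_div.
clearbody w s; rewrite !div1r in h1 h2 h3 *.
have n0 : 0 <= n by lra.
have pLk : 0 <= p * Lc ^+ 2 * ka.
  exact: mulr_ge0 (mulr_ge0 (ltW p0) Lc0) (ltW ka0).
have ze0 : 0 <= 1 + z * eps^-1 by rewrite addr_ge0// mulr_ge0 ?ltW.
have {}h1 : al * (n * Lc ^+ 2 * q * (1 + z * eps^-1)) <
    2 * (1 - rho * (1 + 2 * ex)).
  apply: lt_divr_mul h1 => //.
  exact: mulr_ge0 (mulr_ge0 (mulr_ge0 n0 Lc0) (ltW q0)) ze0.
have {}h3 : al * (LF * z ^+ 2 + 2 * n * (1 + ex^-1) + 3 * p * Lc ^+ 2 * ka) <
    z - eps / 2 * (z + 1).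
  apply: lt_divr_mul h3 => //.
  have := mulr_ge0 LF0 (sqr_ge0 z).
  have : 0 <= n * (1 + ex^-1) by rewrite mulr_ge0//; lra.
  lra.
have {}h2 : al * (1 / 2 * mu * (1 + eps^-1 + 2 * LF) +
    2 * kr * (1 + ex^-1) + 3 * (w * mu)) < ka * (1 - sig * (1 + ey)).
  set D := _ + _ + _ in h2.
  have {}h2 : al * D < 1 - sig * (1 + ey).
    apply: lt_divr_mul h2 => //; rewrite /D.
    have d1 : 0 <= (2 * ka)^-1 * mu * (1 + eps^-1 + 2 * LF).
      by rewrite !mulr_ge0// ?invr_ge0 ?mulr_ge0 ?(ltW ka0)//; lra.
    have d2 : 0 <= 2 * kr * (1 + ex^-1) * ka^-1.
      by rewrite !mulr_ge0// ?(ltW ika)//; lra.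
    have d3 : 0 <= 3 * p * mu * Lc ^+ 2 * (1 + ey^-1).
      apply: mulr_ge0 ey1; apply: mulr_ge0 Lc0.
      by rewrite !mulr_ge0 ?(ltW p0).
    lra.
  have -> : 1 / 2 * mu * (1 + eps^-1 + 2 * LF) + 2 * kr * (1 + ex^-1)
      + 3 * (w * mu) = ka * D.
    rewrite /D [RHS]mulrDr [X in _ = X + _]mulrDr wE invfM; congr (_ + _ + _).
      have -> : ka * (2^-1 * ka^-1 * mu * (1 + eps^-1 + 2 * LF)) =
        (ka * ka^-1) * (1 / 2 * mu * (1 + eps^-1 + 2 * LF)) by lra.
      by rewrite mulfV ?gt_eqF// [RHS]mul1r.
    by rewrite [RHS]mulrC divfK// gt_eqF.
  by rewrite mulrCA ltr_pM2l.
have wle : 12 * w <= 2.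
  have : w * 1 <= w * q by exact: ler_wpM2l.
  lra.
have nx : 2 * (1 + ex^-1) <= n * (1 + ex^-1) by rewrite ler_wpM2r//; lra.
have al4 : al <= 1 / 4.
  have a1 : 0 <= al * (LF * z ^+ 2).
    by rewrite mulr_ge0 ?(ltW al0)// mulr_ge0// sqr_ge0.
  have a2 := mulr_ge0 (ltW al0) pLk.
  have a3 := ler_wpM2l (ltW al0) nx.
  have a4 : 0 < al * ex^-1 by rewrite mulr_gt0.
  have a5 : 0 <= eps * (z + 1) by rewrite mulr_ge0 ?(ltW eps0)//; lra.
  lra.
split.
- lra.
- have k1 : al * (LF * (al * mu)) <= al * (LF * mu).
    rewrite ler_wpM2l ?(ltW al0)// ler_wpM2l// ler_piMl//; lra.
  have k2 : al * (kr * (al * s)) <= al * (kr * (1 + ex^-1)).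
    rewrite ler_wpM2l ?(ltW al0)// ler_wpM2l// sE.
    have := ler_wpM2r (ltW iex) al4; lra.
  have k3 : al * (w * mu * (12 * al)) <= al * (w * mu * 3).
    rewrite ler_wpM2l ?(ltW al0)// ler_wpM2l ?mulr_ge0//; lra.
  lra.
- have -> : LF * al ^+ 2 * z ^+ 2 + s * al ^+ 2 * 2^-1 + 12 * (w * al ^+ 2) =
    al * (al * (LF * z ^+ 2 + s * 2^-1 + 12 * w)) by ring.
  rewrite ltr_pM2l//; apply: le_lt_trans h3; rewrite ler_pM2l// sE.
  lra.
Qed.

(** * Descent sequences for Kurdyka-Lojasiewicz functions *)

(** Besides the inequality at the limit, only the descent property, the gradient
    bound and the bound on steps relative to [gap] matter. *)
Section KLDescent.
Variables (K : realType) (p : nat) (U : 'cV[K]_p -> K).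
Variables (z : nat -> 'cV[K]_p) (zinf : 'cV[K]_p) (gap : nat -> K).
Variables (sg b M c0 theta : K).
Hypothesis sg_gt0 : 0 < sg.
Hypothesis b_gt0 : 0 < b.
Hypothesis M_gt0 : 0 < M.
Hypothesis c0_gt0 : 0 < c0.
Hypothesis theta01 : 0 <= theta < 1.
Hypothesis gap_ge0 : forall nu, 0 <= gap nu.
Hypothesis descent : forall nu, U (z nu.+1) + sg * gap nu <= U (z nu).
Hypothesis grad_le : forall nu, enorm (grad U (z nu)) <= b * Num.sqrt (gap nu).
Hypothesis move_le : forall nu,
  enorm (z nu.+1 - z nu) <= M * Num.sqrt (gap nu).
Hypothesis z_cvg : z @ \oo --> zinf.
Hypothesis U_cvg : (fun nu => U (z nu)) @ \oo --> U zinf.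
Hypothesis KLz : KL_at (fun s => c0 * s `^ (1 - theta)) U zinf.

Let l nu := U (z nu) - U zinf.
Let D nu := Num.sqrt (gap nu).

Let D_ge0 nu : 0 <= D nu. Proof. exact: sqrtr_ge0. Qed.

Let sqrD nu : D nu ^+ 2 = gap nu. Proof. exact: sqr_sqrtr. Qed.

Let l_descent nu : l nu.+1 + sg * gap nu <= l nu.
Proof. by rewrite /l; have := descent nu; lra. Qed.

Let l_step nu : l nu.+1 <= l nu.
Proof. by have := l_descent nu; have := mulr_ge0 (ltW sg_gt0) (gap_ge0 nu); lra. Qed.

Let l_mono nu k : l (nu + k)%N <= l nu.
Proof.
elim: k => [|k IHk]; first by rewrite addn0.
by rewrite addnS (le_trans _ IHk).
Qed.

Let l_ge0 nu : 0 <= l nu.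
Proof.
rewrite subr_ge0; apply: (cvgr_to_le U_cvg).
exists nu => // k /= nuk; have := l_mono nu (k - nu).
by rewrite subnKC// /l lerD2r.
Qed.

Let l_small e : 0 < e -> exists N, forall nu, (N <= nu)%N -> l nu < e.
Proof.
move=> e0; have /cvgrPdist_lt/(_ e e0)[N _ h] := U_cvg.
exists N => nu Nnu; have := h nu Nnu; rewrite distrC => /(le_lt_trans _); apply.
exact: ler_norm.
Qed.

(** The inequality at the limit, rewritten with the derivative of
    [c0 * s `^ (1 - theta)], holds along a tail of the sequence. *)
Let KL_tail : exists N, forall nu, (N <= nu)%N -> 0 < l nu ->
  l nu `^ theta <= c0 * (1 - theta) * b * D nu.
Proof.
have [eta [eta0 [_ _ _ _ near]]] := KLz.
have [N1 _ h1] := z_cvg near.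
have [N2 h2] : exists N, forall nu, (N <= nu)%N -> ((l nu)%:E < eta)%E.
  case: eta eta0 {near h1} => [e e0|_|//]; last by exists 0%N => nu _; rewrite ltry.
  by have [N hN] := l_small e0; exists N => nu /hN; rewrite lte_fin.
have /andP[th0 th1] := theta01.
exists (maxn N1 N2) => nu; rewrite geq_max => /andP[/h1 /= hz /h2 lt_eta] lnu.
have := hz; rewrite -subr_gt0 => /(_ lnu).
have -> : ((U (z nu))%:E < (U zinf)%:E + eta)%E.
  case: eta lt_eta {eta0 near h1 h2 hz} => [e lt_e|_|//]; last by rewrite addey// ltry.
  by rewrite -EFinD lte_fin -ltrBlDl.
move=> /(_ isT); rewrite -/(l nu).
have -> : derive1 (fun s => c0 * s `^ (1 - theta)) (l nu) =
    c0 * ((1 - theta) * (l nu `^ theta)^-1).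
  rewrite derive1Ml; last by apply: derivable_powR; rewrite in_itv /= andbT.
  rewrite powR_derive1 ?in_itv/= ?andbT//.
  by rewrite -powRN; congr (_ * (_ * _ `^ _)); lra.
have P0 : 0 < l nu `^ theta by exact: powR_gt0.
have k0 : 0 <= c0 * ((1 - theta) * (l nu `^ theta)^-1).
  by rewrite !mulr_ge0 ?invr_ge0 ?(ltW P0) ?(ltW c0_gt0)//; lra.
move=> /le_trans /(_ (ler_wpM2l k0 (grad_le nu))).
have -> : c0 * ((1 - theta) / l nu `^ theta) * (b * Num.sqrt (gap nu)) =
  c0 * (1 - theta) * b * D nu / l nu `^ theta by rewrite /D; ring.
by rewrite ler_pdivlMr// mul1r.
Qed.

(** The steps from [nu] on have total length at most a multiple of
    [l nu `^ (1 - theta)], because they are dominated by a telescoping sum; the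
    rates of [l] then carry over to the distance from the limit. *)
Theorem KL_descent_rates :
  [/\ theta = 0 ->
        exists N : nat, forall nu : nat, (N <= nu)%N -> z nu = zinf,
      0 < theta <= 1 / 2 ->
        exists (tau Cbar : K) (nubar : nat), [/\ 0 <= tau < 1, 0 < Cbar &
          forall nu : nat, (nubar <= nu)%N ->
            enorm (z nu - zinf) <= Cbar * tau ^+ nu] &
      1 / 2 < theta < 1 ->
        exists (Cbar : K) (nubar : nat), 0 < Cbar /\
          forall nu : nat, (nubar <= nu)%N ->
            enorm (z nu - zinf) <=
              Cbar * nu%:R `^ (- ((1 - theta) / (2 * theta - 1)))].
Proof.
have /andP[th0 th1] := theta01.
have [N KLN] := KL_tail.
pose q := 1 - theta.
have q0 : 0 < q by rewrite /q; lra.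
have cqb0 : 0 < c0 * q * b by rewrite !mulr_gt0.
pose B := (c0 * q * b) ^+ 2 / sg.
have B0 : 0 < B by rewrite divr_gt0// exprn_gt0.
have l_rec nu : (N <= nu)%N -> 0 < l nu ->
    l nu `^ (2 * theta) <= B * (l nu - l nu.+1).
  move=> Nnu lnu.
  have -> : l nu `^ (2 * theta) = (l nu `^ theta) ^+ 2.
    by rewrite -powR_mulrn ?powR_ge0// -powRrM mulrC.
  apply: (@le_trans _ _ ((c0 * q * b * D nu) ^+ 2)).
    rewrite ler_pXn2r ?nnegrE ?powR_ge0 ?KLN//.
    by rewrite mulr_ge0// ltW.
  rewrite exprMn sqrD /B -[leRHS]mulrA ler_pM2l ?exprn_gt0// ler_pdivlMl//.
  have := l_descent nu; lra.
(* concavity turns the descent into a telescoping bound on the step lengths *)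
have D_le nu : (N <= nu)%N ->
    D nu <= c0 * b / sg * (l nu `^ q - l nu.+1 `^ q).
  move=> Nnu; have [lnu|] := ltP 0 (l nu); last first.
    move=> h; have lnu : l nu = 0 by apply/eqP; rewrite eq_le h l_ge0.
    have lnu1 : l nu.+1 = 0 by apply/eqP; rewrite eq_le l_ge0 -lnu l_step.
    rewrite lnu lnu1 subrr mulr0.
    have : sg * gap nu <= 0 by have := l_descent nu; rewrite lnu lnu1 add0r.
    rewrite pmulr_rle0// => g0; rewrite /D.
    have -> : gap nu = 0 by apply/eqP; rewrite eq_le g0 gap_ge0.
    by rewrite sqrtr0.
  have q01 : 0 <= q <= 1 by rewrite /q; lra.
  have conc := powR_concave_tangent q01 lnu (l_ge0 nu.+1).
  have P0 : 0 < l nu `^ theta by exact: powR_gt0.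
  have PE : l nu `^ (q - 1) = (l nu `^ theta)^-1.
    by rewrite -powRN; congr (_ `^ _); rewrite /q; lra.
  have [D0|DN0] := eqVneq (D nu) 0.
    have := KLN nu Nnu lnu; rewrite D0 mulr0 => /(lt_le_trans P0).
    by rewrite ltxx.
  have Dgt0 : 0 < D nu by rewrite lt_neqAle eq_sym DN0 D_ge0.
  have qP0 : 0 < q * (l nu `^ theta)^-1 by rewrite mulr_gt0 ?invr_gt0.
  rewrite PE in conc.
  have s1 : q * (l nu `^ theta)^-1 * (sg * D nu ^+ 2) <= l nu `^ q - l nu.+1 `^ q.
    apply: le_trans conc; rewrite ler_pM2l// sqrD; have := l_descent nu; lra.
  have s2 : 1 <= c0 * q * b * D nu * (l nu `^ theta)^-1.
    by rewrite ler_pdivlMr// mul1r KLN.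
  apply: (@le_trans _ _ (c0 * b / sg * (q * (l nu `^ theta)^-1 * (sg * D nu ^+ 2)))).
    have -> : c0 * b / sg * (q * (l nu `^ theta)^-1 * (sg * D nu ^+ 2)) =
      (sg / sg) * D nu * (c0 * q * b * D nu * (l nu `^ theta)^-1) by ring.
    by rewrite divff ?gt_eqF// mul1r ler_peMr.
  by rewrite ler_pM2l// divr_gt0// mulr_gt0.
pose A := M * (c0 * b / sg).
have A0 : 0 < A by rewrite mulr_gt0// divr_gt0// mulr_gt0.
have tail nu k : (N <= nu)%N ->
    enorm (z nu - z (nu + k)%N) <= A * (l nu `^ q - l (nu + k)%N `^ q).
  move=> Nnu; elim: k => [|k IHk].
    by rewrite addn0 !subrr enorm0 mulr0.
  rewrite addnS -(subrKA (z (nu + k)%N)); apply: le_trans (enormD _ _) _.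
  have -> : A * (l nu `^ q - l (nu + k).+1 `^ q) =
    A * (l nu `^ q - l (nu + k)%N `^ q) +
    A * (l (nu + k)%N `^ q - l (nu + k).+1 `^ q) by ring.
  rewrite lerD// -enormN opprB; apply: le_trans (move_le _) _.
  by rewrite /A -[leRHS]mulrA ler_pM2l// D_le// (leq_trans Nnu)// leq_addr.
have d_le nu : (N <= nu)%N -> enorm (z nu - zinf) <= A * l nu `^ (1 - theta).
  move=> Nnu; apply: (enorm_lim_le (cvg_vcvg z_cvg)).
  exists nu => // k /= nuk.
  have := tail nu (k - nu)%N Nnu; rewrite subnKC// => /le_trans; apply.
  by rewrite ler_pM2l// gerBl powR_ge0.
have l0 k (_ : (N <= k)%N) := l_ge0 k.
have l1 k (_ : (N <= k)%N) := l_step k.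
split.
- move=> h; have [N' hN'] := finite_rate B0 l0 l1 l_rec d_le h.
  by exists N' => nu /hN' /enorm_le0 /eqP; rewrite subr_eq0 => /eqP.
- move=> h; apply: (linear_rate B0 A0 l0 l1 l_rec d_le h).
  have [N1 hN1] := l_small ltr01.
  by exists N1 => nu /hN1 /ltW.
- exact: (sublinear_rate B0 A0 l0 l1 l_rec d_le).
Qed.

End KLDescent.

(** * The iteration *)

Lemma lipschitz_ge0 (K : realType) (p q : nat) (k : K) (g : 'cV[K]_p.+1 -> 'cV[K]_q) :
  is_lipschitz k g -> 0 <= k.
Proof.
move=> /(_ (delta_mx 0 0) 0) h; have := le_trans (enorm_ge0 _) h.
rewrite subr0 pmulr_lge0// lt_neqAle enorm_ge0 andbT eq_sym.
apply/eqP => e0.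
have /colP/(_ 0) : delta_mx 0 0 = 0 :> 'cV[K]_p.+1.
  by apply: enorm_le0; rewrite e0.
by rewrite !mxE eqxx => /eqP; rewrite oner_eq0.
Qed.

Lemma lipschitz_Lmax (K : realType) (n p q : nat) (L : 'I_n -> K)
    (g : 'I_n -> 'cV[K]_p -> 'cV[K]_q) i :
  is_lipschitz (L i) (g i) -> is_lipschitz (Lmax L) (g i).
Proof.
move=> gL u v; apply: le_trans (gL u v) _; rewrite ler_wpM2r ?enorm_ge0//.
exact: (@le_bigmax _ K _ 0 L).
Qed.

(** A single agent has [rhoR = 0], which leaves no admissible [kappa]. *)
Lemma rhoR_neq0_ge2 (K : realType) (n : nat) (R : 'M[K]_n) (r : 'cV[K]_n) :
  (forall i, \sum_j R i j = 1) -> \sum_i r i 0 = 1 -> rhoR R r != 0 -> (2 <= n)%N.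
Proof.
case: n R r => [|[|//]] R r R1 r1.
  by move: r1; rewrite big_ord0 => /esym/eqP; rewrite oner_eq0.
move=> /eqP[]; rewrite /rhoR.
have -> : R - ones K 1 *m r^T = 0.
  apply/matrixP => i j; rewrite !ord1 !mxE big_ord1 !mxE mul1r.
  have R00 := R1 0; rewrite big_ord1 in R00; rewrite big_ord1 in r1.
  by rewrite R00 r1 subrr.
by rewrite mulmx0 mul0mx opnorm2_0.
Qed.

Section DOGTRates.
Variables (K : realType) (n m : nat) (f : 'I_n -> 'cV[K]_m -> K).
Variables (L : 'I_n -> K) (LF : K) (R C : 'M[K]_n) (r c : 'cV[K]_n).
Variables (epsx epsy eps kappa alpha : K).
Hypothesis df : forall i w, differentiable (f i) w.
Hypothesis f_lip : forall i, is_lipschitz (L i) (grad (f i)).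
Hypothesis F_lip : is_lipschitz LF (grad (Fsum f)).
Hypothesis LF_ge0 : 0 <= LF.
Hypothesis R_row : forall i, \sum_j R i j = 1.
Hypothesis C_col : forall j, \sum_i C i j = 1.
Hypothesis r_gt0 : forall i, 0 < r i 0.
Hypothesis r_sum : \sum_i r i 0 = 1.
Hypothesis rR : r^T *m R = r^T.
Hypothesis c_gt0 : forall i, 0 < c i 0.
Hypothesis c_sum : \sum_i c i 0 = 1.
Hypothesis Cc : C *m c = c.
Hypothesis adm : admissible R C r c (Lmax L) LF epsx epsy eps kappa alpha.

Notation mean := (wmean (fun i => r i 0)).
Notation Lc := (Lmax L).

Let Lc_lip i : is_lipschitz Lc (grad (f i)).
Proof. exact: (lipschitz_Lmax (g := fun i => grad (f i)) (f_lip i)). Qed.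

(** The squared distance to the stationary states: it vanishes when the [x]
    blocks agree, the [y] blocks are proportional to [c], and the tracked
    gradient is zero. *)
Definition gap (X Y : 'I_n -> 'cV[K]_m) : K :=
  xgap r X + ygap c Y + nsq (\sum_i Y i).

Lemma xgap_ge0 X : 0 <= xgap (m := m) r X.
Proof. by apply: wsq_ge0 => i; exact: ltW. Qed.

Lemma ygap_ge0 Y : 0 <= ygap (m := m) c Y.
Proof. by apply: wsq_ge0 => i; rewrite invr_ge0 ltW. Qed.

Lemma gap_ge0 X Y : 0 <= gap X Y.
Proof. by rewrite !addr_ge0 ?xgap_ge0 ?ygap_ge0 ?nsq_ge0. Qed.

Lemma agents_ge2 : (2 <= n)%N.
Proof.
apply: (rhoR_neq0_ge2 R_row r_sum); apply/eqP => h.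
have := lt_le_trans (kappa_gt0 adm) (kappa_le adm).
by rewrite h expr0n/= !mul0r ltxx.
Qed.

Let rho_lt1 : rhoR R r ^+ 2 <= 1.
Proof.
have := epsx_lt adm; have := epsx_gt0 adm; have := sqr_ge0 (rhoR R r).
nra.
Qed.

Lemma grad_diff_le X Y X1 : X1 = (fun i => mix R X i - alpha *: Y i) ->
  wsq (fun=> 1) (fun i => grad (f i) (X1 i) - grad (f i) (X i)) <=
  Lc ^+ 2 * (24 / 5 * ((vmin r)^-1 * xgap r X) +
  12 * (alpha ^+ 2 * (nsq (\sum_i Y i) + vmax c * ygap c Y))).
Proof.
move=> ->; set X1' := (fun i => mix R X i - alpha *: Y i).
apply: (@le_trans _ _ (Lc ^+ 2 * wsq (fun=> 1) (fun i => X1' i - X i))).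
  rewrite -wsqZl; apply: ler_wsq => i; rewrite mul1r mulr1.
  exact: (lipschitz_sqr _ _ (Lc_lip i)).
by rewrite ler_wpM2l ?sqr_ge0// move_step.
Qed.

(** The Young parameters are [2 / 5 * epsx] for the consensus error and [epsy]
    for the tracking error. *)
Lemma merit_descent : exists2 sg : K, 0 < sg &
  forall X Y X1 Y1, \sum_i Y i = \sum_i grad (f i) (X i) ->
  X1 = (fun i => mix R X i - alpha *: Y i) ->
  Y1 = (fun i => mix C Y i + (grad (f i) (X1 i) - grad (f i) (X i))) ->
  Fsum f (mean X1) + xgap r X1 + kappa * ygap c Y1 + sg * gap X Y <=
  Fsum f (mean X) + xgap r X + kappa * ygap c Y.
Proof.
have n2 : (2 <= n%:R :> K) by rewrite ler_nat agents_ge2.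
have n0 : (0 < n)%N by rewrite (leq_trans _ agents_ge2).
have rmin0 := vmin_gt0 r_gt0; have cmin0 := vmin_gt0 c_gt0.
have q1 : 1 <= (vmin r)^-1 by rewrite invf_ge1// vmin_le1.
have p0 : 0 < (vmin c)^-1 by rewrite invr_gt0.
have z01 : 0 < zeta r c <= 1 by rewrite zeta_gt0 ?zeta_le1.
have kr0 : 0 <= vmax r * vmax c by rewrite mulr_ge0 ?vmax_ge0.
have [ex0 exlt ey0 eylt eps0 epslt ka0 kale al0 al1 al2 al3] := adm.
rewrite /K6 /K2R /KC2 !sqr_inv_sqrt_vmin// in kale.
rewrite /K2R !sqr_inv_sqrt_vmin// in al1.
rewrite /K2 /K4 /KRC /K2C /KC2 !sqr_inv_sqrt_vmin// sqr_sqrt_vmax sqr_sqrtr// in al2.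
rewrite /K3 /K5 /KC2 !sqr_inv_sqrt_vmin// in al3.
have [cA cB cG] := stepsize_slack n2 LF_ge0 q1 p0 (vmax_ge0 c) kr0 z01
  (sqr_ge0 (rhoR R r)) ex0 exlt ey0 eps0 ka0 kale al0 al1 al2 al3.
set w := kappa * _ * _ * _ in cA cB cG; set t := 1 + _^-1 in cB cG.
set cAl := (X in X < 1) in cA; set cBl := (X in X < kappa) in cB.
set cGl := (X in X < _) in cG; set cGr := alpha * _ in cG.
pose sg := Num.min (1 - cAl) (Num.min (kappa - cBl) (cGr - cGl)).
exists sg; first by rewrite !lt_min !subr_gt0 cA cB cG.
have [sA sB sG] : [/\ sg <= 1 - cAl, sg <= kappa - cBl & sg <= cGr - cGl].
  by split; rewrite /sg !ge_min lexx ?orbT.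
move=> X Y X1 Y1 track X1E Y1E.
set D := (fun i => grad (f i) (X1 i) - grad (f i) (X i)).
have t0 : 0 < 2 / 5 * epsx by rewrite mulr_gt0//; lra.
have hx := xgap_step r_gt0 c_gt0 r_sum c_sum R_row rR alpha X Y t0.
have hy := ygap_step c_gt0 c_sum C_col Cc Y D ey0.
have hF := objective_step r_gt0 c_gt0 r_sum rR df Lc_lip F_lip LF_ge0
  eps0 al0 n0 track.
have hD : wsq (fun=> 1) D <= _ := grad_diff_le X1E.
have kw : 0 <= kappa * (1 + epsy^-1) * (vmin c)^-1.
  by rewrite !mulr_ge0 ?(ltW ka0) ?(ltW p0)// addr_ge0// invr_ge0 ltW.
have {}hD := ler_wpM2l kw hD; have {}hy := ler_wpM2l (ltW ka0) hy.
have eA := ler_wpM2r (xgap_ge0 X) sA.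
have eB := ler_wpM2r (ygap_ge0 Y) sB.
have eG := ler_wpM2r (nsq_ge0 (\sum_i Y i)) sG.
move: hx hy hF hD eA eB eG; rewrite -X1E -Y1E /gap /cAl /cBl /cGl /cGr /w /t.
clearbody sg; clear sA sB sG; move: sg (xgap r X1) (ygap c Y1) (wsq _ D)
  (Fsum f (mean X1)) (Fsum f (mean X)) (xgap r X) (ygap c Y) (nsq _)
  (rhoR R r ^+ 2) (rhoC C c ^+ 2) (zeta r c) (n%:R : K) (vmin r)^-1 (vmin c)^-1
  (2 / 5 * epsx)^-1 epsy^-1 eps^-1.
clear=> *; lra.
Qed.

Notation U := (fun w => merit f r c kappa (usubmx w) (dsubmx w)).

(** The gradient of the objective at the average is the tracked gradient up to
    the consensus error, so [gap] controls all parts of the gradient. *)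
Lemma grad_merit_le : exists2 b : K, 0 < b & forall w,
  let X := blk (usubmx w) in let Y := blk (dsubmx w) in
  \sum_i Y i = \sum_i grad (f i) (X i) ->
  enorm (grad U w) <= b * Num.sqrt (gap X Y).
Proof.
have [M M0 hM] := merit_grad_bound r_gt0 c_gt0 df (ltW (kappa_gt0 adm)).
pose E := n%:R * Lc ^+ 2 * (vmin r)^-1.
have E0 : 0 <= E.
  have q0 : 0 <= (vmin r)^-1 by rewrite invr_ge0 ltW// vmin_gt0.
  exact: mulr_ge0 (mulr_ge0 (ler0n _ _) (sqr_ge0 _)) q0.
pose S := Num.sqrt (2 + 2 * E).
have S0 : 0 <= S by exact: sqrtr_ge0.
exists (M * (S + 2)); first by rewrite mulr_gt0// ltr_wpDl.
move=> w X Y track; apply: le_trans (hM w) _; rewrite -mulrA ler_pM2l// -/X -/Y.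
set ys := \sum_i Y i in track.
have x0 := xgap_ge0 X; have y0 := ygap_ge0 Y; have g0 := nsq_ge0 ys.
have le1 : Num.sqrt (xgap r X) <= Num.sqrt (gap X Y).
  by rewrite ler_wsqrtr// /gap -/ys; lra.
have le2 : Num.sqrt (ygap c Y) <= Num.sqrt (gap X Y).
  by rewrite ler_wsqrtr// /gap -/ys; lra.
have le3 : enorm (grad (Fsum f) (mean X)) <= S * Num.sqrt (gap X Y).
  rewrite /S -sqrtrM; last by lra.
  apply: enorm_le_sqrt; set G := grad _ _.
  have -> : G = (G - ys) + ys by rewrite subrK.
  apply: le_trans (nsqD_young _ _ ltr01) _; rewrite invr1.
  have := grad_err r_gt0 df Lc_lip X; rewrite -/G -track -/E => h.
  rewrite /gap -/ys.
  have := mulr_ge0 E0 y0; have := mulr_ge0 E0 g0; lra.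
lra.
Qed.

(** Both [R - I] and [C - I] annihilate the stationary part of the blocks, and
    the gradient increments are at most [Lc] times the moves of [X]. *)
Lemma step_length : exists2 M : K, 0 < M & forall X Y X1 Y1,
  X1 = (fun i => mix R X i - alpha *: Y i) ->
  Y1 = (fun i => mix C Y i + (grad (f i) (X1 i) - grad (f i) (X i))) ->
  wsq (fun=> 1) (fun i => X1 i - X i) + wsq (fun=> 1) (fun i => Y1 i - Y i)
    <= M * gap X Y.
Proof.
pose mu := vmax c; pose q := (vmin r)^-1.
have mu0 : 0 <= mu by exact: vmax_ge0.
have q0 : 0 <= q by rewrite invr_ge0 ltW// vmin_gt0.
pose P := 24 / 5 * q + 12 * alpha ^+ 2 * (1 + mu).
have a0 := sqr_ge0 alpha; have amu0 := mulr_ge0 a0 mu0.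
have P0 : 0 <= P by rewrite /P; lra.
have L0 := sqr_ge0 Lc; have s0 := sqr_ge0 (rhoC C c).
have LP0 := mulr_ge0 L0 P0; have mus0 := mulr_ge0 mu0 s0.
exists (P + 2 * (mu * (2 * rhoC C c ^+ 2 + 2)) + 2 * (Lc ^+ 2 * P) + 1).
  by lra.
move=> X Y X1 Y1 X1E Y1E.
have x0 := xgap_ge0 X; have y0 := ygap_ge0 Y; have g0 := nsq_ge0 (\sum_i Y i).
have gap0 := gap_ge0 X Y.
have hP : 24 / 5 * (q * xgap r X) +
    12 * (alpha ^+ 2 * (nsq (\sum_i Y i) + mu * ygap c Y)) <= P * gap X Y.
  rewrite /P /gap.
  have := mulr_ge0 q0 y0; have := mulr_ge0 q0 g0.
  have := mulr_ge0 a0 x0; have := mulr_ge0 a0 y0.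
  have := mulr_ge0 amu0 x0; have := mulr_ge0 amu0 g0.
  lra.
have hX : wsq (fun=> 1) (fun i => X1 i - X i) <= P * gap X Y.
  rewrite X1E; apply: le_trans hP.
  exact: (move_step r_gt0 c_gt0 r_sum c_sum R_row alpha X Y rho_lt1).
have hD := le_trans (grad_diff_le X1E) (ler_wpM2l L0 hP).
have -> : (fun i => Y1 i - Y i) = (fun i => (mix C (ydev c Y) i - ydev c Y i) +
    (grad (f i) (X1 i) - grad (f i) (X i))).
  apply/funext => i; rewrite Y1E addrAC; congr (_ + _).
  by rewrite /ydev mix_dist (mixC_c Cc) opprB addrA subrK.
have hY : wsq (fun=> 1) (fun i => mix C (ydev c Y) i - ydev c Y i) <=
    mu * ((2 * rhoC C c ^+ 2 + 2) * ygap c Y).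
  apply: le_trans (wsq1_le_vmax c_gt0 _) _; rewrite ler_wpM2l//.
  apply: le_trans (wsqB_young _ _ ltr01 _) _.
    by move=> i; rewrite invr_ge0 ltW.
  have := mixC_contract C c_gt0 (sum_ydev c_sum Y).
  rewrite invr1 /ygap; lra.
have hYg : mu * ((2 * rhoC C c ^+ 2 + 2) * ygap c Y) <=
    mu * ((2 * rhoC C c ^+ 2 + 2) * gap X Y).
  rewrite ler_wpM2l// ler_wpM2l//; first by lra.
  by rewrite /gap; lra.
have := wsqD_young (fun i => mix C (ydev c Y) i - ydev c Y i)
  (fun i => grad (f i) (X1 i) - grad (f i) (X i)) ltr01 (fun=> ler01).
rewrite invr1; lra.
Qed.

End DOGTRates.

(** Mixing by [C] preserves the sum of the blocks, so the sum changes only by the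
    gradient increments; the correction in the range of [C - I] at the start has
    sum 0. *)
Lemma DOGT_track (K : realType) (n m : nat) (f : 'I_n -> 'cV[K]_m -> K)
    (R C : 'M[K]_n) (alpha : K) (x y : nat -> 'cV[K]_(n * m)) :
  (forall i w, differentiable (f i) w) -> (forall j, \sum_i C i j = 1) ->
  DOGT f R C alpha x y ->
  forall nu, \sum_i blk (y nu) i = \sum_i grad (f i) (blk (x nu) i).
Proof.
move=> df C_col [[w y0] _ yS].
have Csum (u : 'cV[K]_(n * m)) : \sum_i blk (kronI m C *m u) i = \sum_i blk u i.
  by under eq_bigr => i _ do rewrite blk_kronI; exact: sum_mixC.
have gE u : \sum_i blk (grad (Fc f) u) i = \sum_i grad (f i) (blk u i).
  by apply: eq_bigr => i _; rewrite blk_grad_Fc.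
elim=> [|nu IH].
  rewrite y0 mulmxBl mul1mx; under eq_bigr => i _ do rewrite !blkD blkN.
  by rewrite !big_split /= sumrN Csum subrr addr0 gE.
rewrite yS; under eq_bigr => i _ do rewrite !blkD blkN.
by rewrite !big_split /= sumrN Csum !gE IH addrAC subrr add0r.
Qed.

Lemma nsq_col_mx (K : realType) (p q : nat) (u : 'cV[K]_p) (v : 'cV[K]_q) :
  nsq (col_mx u v) = nsq u + nsq v.
Proof.
rewrite !dotE big_split_ord /=; congr (_ + _); apply: eq_bigr => i _.
  by rewrite col_mxEu.
by rewrite col_mxEd.
Qed.

Theorem theorem4p8 (K : realType) (n m k : nat)
    (f : 'I_n -> 'cV[K]_m -> K) (L : 'I_n -> K) (LF : K)
    (e : rel 'I_n) (R C : 'M[K]_n) (r c : 'cV[K]_n)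
    (epsx epsy eps kappa alpha c0 theta : K)
    (x y : nat -> 'cV[K]_(n * m)) (zinf : 'cV[K]_(n * m + n * m)) :
  let z := fun nu => col_mx (x nu) (y nu) in
  (1 <= k)%N ->
  (forall i, is_Ck k.+1 (f i)) ->
  (forall i, is_lipschitz (L i) (grad (f i))) ->
  is_lipschitz LF (grad (Fsum f)) ->
  coercive (Fsum f) ->
  real_analytic (Fsum f) ->
  strongly_connected e ->
  weight_assumption e R C ->
  stochastic_vec r -> r^T *m R = r^T -> (forall i, 0 < r i 0) ->
  stochastic_vec c -> C *m c = c -> (forall i, 0 < c i 0) ->
  admissible R C r c (Lmax L) LF epsx epsy eps kappa alpha ->
  0 < c0 -> 0 <= theta < 1 ->
  KL_function (fun s => c0 * s `^ (1 - theta))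
    (fun w => merit f r c kappa (usubmx w) (dsubmx w)) ->
  DOGT f R C alpha x y ->
  z @ \oo --> zinf ->
  [/\ theta = 0 ->
        exists N : nat, forall nu : nat, (N <= nu)%N -> z nu = zinf,
      0 < theta <= 1 / 2 ->
        exists (tau Cbar : K) (nubar : nat), [/\ 0 <= tau < 1, 0 < Cbar &
          forall nu : nat, (nubar <= nu)%N ->
            enorm (z nu - zinf) <= Cbar * tau ^+ nu] &
      1 / 2 < theta < 1 ->
        exists (Cbar : K) (nubar : nat), 0 < Cbar /\
          forall nu : nat, (nubar <= nu)%N ->
            enorm (z nu - zinf) <=
              Cbar * nu%:R `^ (- ((1 - theta) / (2 * theta - 1)))].
Proof.
case: m f x y zinf => [|m] f x y zinf z _ fCk f_lip F_lip _ _ _ wa [_ r_sum] rR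
    r_gt0 [_ c_sum] Cc c_gt0 adm c0_gt0 th01 KL dogt zl.
  (* without coordinates LF may be negative, but all vectors are equal *)
  have zE nu : z nu = zinf.
    by apply/colP => -[i i_lt]; exfalso; move: i_lt; rewrite muln0.
  split=> _.
  - by exists 0%N => nu _.
  - exists 0, 1, 0%N; rewrite lexx ltr01; split=> // nu _.
    by rewrite zE subrr enorm0 mul1r exprn_ge0.
  - exists 1, 0%N; split=> // nu _.
    by rewrite zE subrr enorm0 mul1r powR_ge0.
have df i w : differentiable (f i) w := is_Ck_differentiable (fCk i) w.
have LF0 : 0 <= LF := lipschitz_ge0 F_lip.
have [_ R_row _ _ C_col _ _ _ _ _ _] := wa.
have track := DOGT_track df C_col dogt.
have [_ xS yS] := dogt.
have xE nu : blk (x nu.+1) = (fun i => mix R (blk (x nu)) i - alpha *: blk (y nu) i).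
  by apply/funext => i; rewrite xS blkD blkN blkZ blk_kronI.
have yE nu : blk (y nu.+1) = (fun i => mix C (blk (y nu)) i +
    (grad (f i) (blk (x nu.+1) i) - grad (f i) (blk (x nu) i))).
  by apply/funext => i; rewrite yS !blkD blkN blk_kronI !blk_grad_Fc// addrA.
have [sg sg0 hdesc] := merit_descent df f_lip F_lip LF0 R_row C_col r_gt0 r_sum
  rR c_gt0 c_sum Cc adm.
have [b b0 hgrad] := grad_merit_le df f_lip r_gt0 c_gt0 adm.
have [M M0 hmove] := step_length f_lip R_row r_gt0 r_sum c_gt0 c_sum Cc adm.
pose gp nu := gap r c (blk (x nu)) (blk (y nu)).
have gp0 nu : 0 <= gp nu by exact: gap_ge0.
pose U := fun w : 'cV[K]_(n * m.+1 + n * m.+1) =>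
  merit f r c kappa (usubmx w) (dsubmx w).
have sM0 : 0 < Num.sqrt M by rewrite sqrtr_gt0.
apply: (@KL_descent_rates K _ U z zinf gp sg b (Num.sqrt M) c0 theta) => //.
- move=> nu; rewrite /U /z !col_mxKu !col_mxKd !meritE// /gp.
  exact: hdesc (track nu) (xE nu) (yE nu).
- move=> nu; have := hgrad (z nu); rewrite /z !col_mxKu !col_mxKd; apply.
  exact: track.
- move=> nu; rewrite -sqrtrM ?(ltW M0)//; apply: enorm_le_sqrt.
  rewrite /z opp_col_mx add_col_mx nsq_col_mx !nsq_blk.
  have := hmove _ _ _ _ (xE nu) (yE nu).
  rewrite -/(gp nu) => /(le_trans _); apply.
  rewrite le_eqVlt; apply/orP; left; apply/eqP.
  by congr (_ + _); apply: eq_bigr => i _; rewrite mul1r blkD blkN.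
- exact: merit_cvg.
Qed.
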